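(* Let $a>0$, $0<r\le r_0$, $\tau>0$ and $K\in S(a)$. Among all baseline functions $b:\mathbb R^n\to\mathbb R$, the variance of the estimated gradient $$\bar\nabla f(K):=\frac1{rN}\sum_{i=1}^N\left(\tilde f_\tau(K+rU_i;x_i(0))-b(x_i(0))\right)U_i$$ is minimized by the optimal baseline $$b^*(x(0))=E_{U\sim\mathcal S}\left[\tilde f_\tau(K+rU;x(0))\right],$$ and, moreover, $$\lim_{r\to0}b^*(x(0))=\tilde f_\tau(K;x(0)).$$
   Context: Setting. $A\in\mathbb R^{n\times n}$, $B\in\mathbb R^{n\times m}$, $C\in\mathbb R^{p\times n}$ with $B\ne0$, $C\neq 0$; $Q\in\mathbb R^{p\times p}$, $R\in\mathbb R^{m\times m}$ are (symmetric) positive definite; $\mathcal D$ is a probability distribution on $\mathbb R^n$ with $\Sigma:=E_{x(0)\sim\mathcal D}[x(0)x(0)^\top]\succ0$ and $\|x(0)\|\le P$ almost surely for a constant $P>0$; the pair $(A,C)$ is observable. For $K\in\mathbb R^{m\times p}$ put $A_K:=A-BKC$ and $S:=\{K\in\mathbb R^{m\times p}: A_K\text{ is Hurwitz}\}$ (all eigenvalues have negative real part). $\Omega\subset\mathbb R^{m\times p}$ is a closed convex set, and it is assumed that there is some $K_0\in\Omega\cap S$. For $K\in S$, $$f(K):=E_{x(0)\sim\mathcal D}\left[\int_0^\infty x(0)^\top e^{A_K^\top t}C^\top(Q+K^\top RK)Ce^{A_Kt}x(0)\,dt\right],$$ and $S(a):=\{K\in S: f(K)\le a\}$. The finite horizon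 cost is $$\tilde f_\tau(K;v):=\int_0^\tau v^\top e^{A_K^\top t}C^\top(Q+K^\top RK)Ce^{A_Kt}v\,dt,\qquad v\in\mathbb R^n.$$ $\mathcal S$ is the uniform distribution on $\{U\in\mathbb R^{m\times p}:\|U\|_F=\sqrt{mp}\}$ ($\|\cdot\|_F$ the Frobenius norm). $U_1,\dots,U_N\sim\mathcal S$ and $x_1(0),\dots,x_N(0)\sim\mathcal D$ are all mutually independent. The variance of a random matrix $Z$ is $V[Z]:=E[\|Z-E[Z]\|_F^2]$. Baselines are understood to be measurable functions. The constant $r_0>0$ is such that for all $0<r\le r_0$, all $K\in S(a)$ and all $U$ with $\|U\|_F=\sqrt{mp}$ one has $K+rU\in S(2a)$. *)

(* Defs.v *)
From HB Require Import structures.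
From mathcomp Require Import all_boot all_order all_algebra.
From mathcomp Require Import all_classical all_reals all_analysis.
From mathcomp Require Import complex.

Set Implicit Arguments.
Unset Strict Implicit.
Unset Printing Implicit Defensive.

Import Order.TTheory GRing.Theory Num.Theory.
Import numFieldNormedType.Exports.

Local Open Scope classical_set_scope.
Local Open Scope ring_scope.

(* R^(m x n) and R^n with their Borel sigma-algebras; the carriers are
   convertible to 'M[R]_(m, n) and 'cV[R]_n. *)
Notation borel_mx R m n := (g_sigma_algebraType (@open 'M[R]_(m, n))).
Notation borel_cV R n := (g_sigma_algebraType (@open 'cV[R]_n)).

Section LinearAlgebra.
Variable R : realType.

Definition frob m n (M : 'M[R]_(m, n)) : R :=
  Num.sqrt (\sum_i \sum_j M i j ^+ 2).

Definition posdef n (M : 'M[R]_n) : Prop :=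
  M^T = M /\ forall v : 'cV[R]_n, v != 0 -> 0 < (v^T *m M *m v) ord0 ord0.

Definition expm n (A : 'M[R]_n) : 'M[R]_n :=
  limn (series (fun k => k`!%:R^-1 *: A ^+ k)).

Definition hurwitz n (A : 'M[R]_n) : Prop :=
  forall z : complex.complex R,
    eigenvalue (map_mx (complex.real_complex R) A) z -> complex.Re z < 0.

(* The initial state of x' = A x is determined by the output C x on [0, +oo[. *)
Definition observable n p (A : 'M[R]_n) (C : 'M[R]_(p, n)) : Prop :=
  forall v : 'cV[R]_n,
    (forall t : R, 0 <= t -> C *m expm (t *: A) *m v = 0) -> v = 0.

End LinearAlgebra.

Section Probability.
Variable R : realType.

(* The uniform distribution on the Frobenius sphere of radius sqrt (m p): the
   probability measure carried by that sphere and invariant under the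
   orthogonal group of the Euclidean space R^(m x p), which acts on
   vectorized matrices. *)
Definition uniform_sphere m p (S : probability (borel_mx R m p) R) : Prop :=
  S [set U : 'M[R]_(m, p) | frob U = Num.sqrt (m * p)%:R] = 1%E /\
  forall O : 'M[R]_(m * p), O *m O^T = 1%:M ->
  forall E : set (borel_mx R m p), measurable E ->
    S ((fun U : 'M[R]_(m, p) => vec_mx (mxvec U *m O)) @^-1` E) = S E.

Context d (T : measurableType d) (P : probability T R).

Definition mutually_independent (I : finType) (G : I -> set (set T)) : Prop :=
  forall (J : {set I}) (E : I -> set T),
    (forall i, i \in J -> G i (E i)) ->
    P (\bigcap_(i in [set` J]) E i) = (\prod_(i in J) P (E i))%E.

Definition sigma_of d' (T' : measurableType d') (X : T -> T') : set (set T) :=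
  preimage_set_system setT X measurable.

Definition mxmean m n (Z : T -> 'M[R]_(m, n)) : 'M[R]_(m, n) :=
  \matrix_(i, j) fine 'E_P[fun w => Z w i j]%E.

(* Extended-real valued.  When an entry of Z is not integrable, the
   corresponding entry of mxmean is a meaningless real number, but the variance
   is +oo whatever this number is. *)
Definition mxvar m n (Z : T -> 'M[R]_(m, n)) : \bar R :=
  'E_P[fun w => (frob (Z w - mxmean Z) ^+ 2)%R]%E.

End Probability.

Section OutputFeedback.
Variables (R : realType) (n m p : nat).
Variables (A : 'M[R]_n) (B : 'M[R]_(n, m)) (C : 'M[R]_(p, n)).
Variables (Q : 'M[R]_p) (Rw : 'M[R]_m).
Implicit Types (K : 'M[R]_(m, p)) (v x : 'cV[R]_n).

Definition closed_loop K : 'M[R]_n := A - B *m K *m C.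

Definition stabilizing : set 'M[R]_(m, p) := [set K | hurwitz (closed_loop K)].

Definition running_cost K v (t : R) : R :=
  (v^T *m expm (t *: (closed_loop K)^T) *m C^T *m (Q + K^T *m Rw *m K) *m C
     *m expm (t *: closed_loop K) *m v) ord0 ord0.

Definition cost (D : probability (borel_cV R n) R) K : \bar R :=
  (\int[D]_x \int[lebesgue_measure]_(t in `[0%R, +oo[)
     (running_cost K x t)%:E)%E.

Definition sublevel (D : probability (borel_cV R n) R) (a : R) :
    set 'M[R]_(m, p) :=
  [set K | stabilizing K /\ (cost D K <= a%:E)%E].

Definition finite_cost (tau : R) K v : R :=
  \int[lebesgue_measure]_(t in `[0, tau]) running_cost K v t.

Definition grad_estimate (tau r : R) (N : nat) K (b : 'cV[R]_n -> R)
    (U : 'I_N -> 'M[R]_(m, p)) (x : 'I_N -> 'cV[R]_n) : 'M[R]_(m, p) :=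
  (r * N%:R)^-1 *:
    \sum_(i < N) (finite_cost tau (K + r *: U i) (x i) - b (x i)) *: U i.

Definition opt_baseline (S : probability (borel_mx R m p) R) (tau r : R) K x :
    R :=
  fine 'E_S[fun U => (finite_cost tau (K + r *: (U : 'M[R]_(m, p))) x)%R]%E.

End OutputFeedback.

(* Main.v *)
Require Import Defs.
From HB Require Import structures.
From mathcomp Require Import all_boot all_order all_algebra.
From mathcomp Require Import all_classical all_reals all_analysis.
From mathcomp Require Import measurable_realfun.
From mathcomp Require Import ring lra.

Set Implicit Arguments.
Unset Strict Implicit.
Unset Printing Implicit Defensive.

Import Order.TTheory GRing.Theory Num.Theory.
Import numFieldNormedType.Exports.

Local Open Scope classical_set_scope.
Local Open Scope ring_scope.

(** Write F(V, x) for the finite-horizon cost of the perturbed gain K + r V from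
    the initial state x, and b0 for the optimal baseline, the mean of F(., x)
    over the sphere.

    Let b be another baseline, h := b - b0 and W := Z(b0) - Z(b), where Z(b) is
    the estimator with baseline b.  Then W is a multiple of the sum of the
    h(X_i) U_i.  Each U_i has mean zero and is independent of everything else,
    so W has mean zero and, in the inner product of Z(b0) with W, the terms
    pairing two different samples have mean zero (mean_Phiu_hu_cross).  The
    term of a single sample is a multiple of (F(U_i, X_i) - b0(X_i)) h(X_i),
    because U_i has constant norm, and has mean zero by the choice of b0
    (mean_Phiu_hu_diag).  Hence Z(b0) and W are orthogonal and Z(b), which is
    the difference of the two, has the larger variance
    (estimator_variance_min).

    These computations require h(X_i) to be square integrable, while b is an
    arbitrary measurable function.  If the variance of Z(b) is infinite there
    is nothing to prove.  Otherwise W is square integrable, and each h(X_i) is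
    recovered from W on the event that the other weights h(X_j) are bounded,
    an event of positive probability independent of X_i
    (weight_sq_integrable).

    The analytic input is that the cost is a quadratic form in x whose
    coefficients are Lipschitz on bounded sets of gains, since the matrix
    exponential is (expmB_norm).  This gives the measurability and the
    boundedness of F and of b0, and the bound b0(x) - F(0, x) = O(r), from
    which the limit follows (opt_baseline_cvg). *)

(** * The matrix exponential *)

(** Matrices over the reals form a complete normed space, so absolutely
    convergent series of matrices converge. *)
HB.instance Definition _ (R : realType) (m n : nat) :=
  Complete.on (matrix R m n).

Section MatrixNorm.
Variable R : realType.

Lemma coord_le_mx_norm m n (M : 'M[R]_(m, n)) i j : `|M i j| <= `|M|.
Proof.
rewrite [leRHS]/Num.norm /= mx_normrE.
by apply/bigmax_geP; right => /=; exists (i, j).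
Qed.

Lemma mx_norm_le m n (M : 'M[R]_(m, n)) c :
  0 <= c -> (forall i j, `|M i j| <= c) -> `|M| <= c.
Proof.
by move=> c0 Mc; rewrite [leLHS]/Num.norm /= mx_normrE; apply/bigmax_leP; split.
Qed.

(** The norm of a matrix is the largest modulus of its entries, hence the
    factor n. *)
Lemma mulmx_norm m n p (A : 'M[R]_(m, n)) (B : 'M[R]_(n, p)) :
  `|A *m B| <= n%:R * `|A| * `|B|.
Proof.
apply: mx_norm_le => [|i j]; first by rewrite !mulr_ge0.
rewrite mxE (le_trans (ler_norm_sum _ _ _))//.
rewrite (@le_trans _ _ (\sum_(k < n) `|A| * `|B|))//.
  by apply: ler_sum => k _; rewrite normrM ler_pM// coord_le_mx_norm.
by rewrite sumr_const card_ord mulr_natl mulrnAl.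
Qed.

Lemma mx_norm1 n : `|1%:M : 'M[R]_n| <= 1.
Proof.
by apply: mx_norm_le => // i j; rewrite mxE; case: eqP; rewrite ?normr1 ?normr0.
Qed.

Lemma expmx_norm n (A : 'M[R]_n) c k : n%:R * `|A| <= c -> `|A ^+ k| <= c ^+ k.
Proof.
move=> Ac; elim: k => [|k IH]; first by rewrite !expr0 mx_norm1.
rewrite !exprS (le_trans (mulmx_norm _ _))//.
by rewrite ler_pM// mulr_ge0.
Qed.

(** The natural Lipschitz constant of the k-th power is k c^(k-1); the larger
    (2 c)^k is the one that sums to an exponential. *)
Lemma expmxB_norm n (A B : 'M[R]_n) c k : 1 <= c ->
  n%:R * `|A| <= c -> n%:R * `|B| <= c ->
  `|A ^+ k - B ^+ k| <= (2 * c) ^+ k * (n%:R * `|A - B|).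
Proof.
move=> c1 Ac Bc.
have c0 : 0 <= c by rewrite (le_trans _ c1).
elim: k => [|k IH]; first by rewrite !expr0 subrr normr0 mul1r mulr_ge0.
have -> : A ^+ k.+1 - B ^+ k.+1 = A *m (A ^+ k - B ^+ k) + (A - B) *m B ^+ k.
  by rewrite !exprS mulmxBr mulmxBl addrA subrK.
rewrite (le_trans (ler_normD _ _))//.
have d0 : 0 <= n%:R * `|A - B| by rewrite mulr_ge0.
have ck : c ^+ k <= (2 * c) ^+ k.
  by rewrite lerXn2r// ?nnegrE ?mulr_ge0// ler_peMl// ler1n.
have h1 : `|A *m (A ^+ k - B ^+ k)| <= c * ((2 * c) ^+ k * (n%:R * `|A - B|)).
  by rewrite (le_trans (mulmx_norm _ _))// ler_pM// mulr_ge0.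
have h2 : `|(A - B) *m B ^+ k| <= c * ((2 * c) ^+ k * (n%:R * `|A - B|)).
  rewrite (le_trans (mulmx_norm _ _))// mulrC.
  apply: (@le_trans _ _ ((2 * c) ^+ k * (n%:R * `|A - B|))).
    by rewrite ler_wpM2r// (le_trans (expmx_norm _ Bc)).
  by rewrite ler_peMl// mulr_ge0// exprn_ge0// mulr_ge0.
rewrite (le_trans (lerD h1 h2))// [in leRHS]exprS; lra.
Qed.

(** The exponential series converges absolutely. *)
Lemma is_cvg_expm n (A : 'M[R]_n) :
  cvgn (series (fun k => k`!%:R^-1 *: A ^+ k)).
Proof.
apply: normed_cvg.
apply: (@series_le_cvg _ _ (exp_coeff (n%:R * `|A|))) => [k|k|k|] //=.
- by rewrite /exp_coeff /= mulr_ge0// ?invr_ge0 ?exprn_ge0// mulr_ge0.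
- rewrite normrZ ger0_norm ?invr_ge0// exp_coeffE /= ler_wpM2l ?invr_ge0//.
  exact: expmx_norm.
- exact: is_cvg_series_exp_coeff.
Qed.

Lemma series_exp_coeff_le (x : R) N : 0 <= x ->
  series (exp_coeff x) N <= expR x.
Proof.
move=> x0; apply: nondecreasing_cvgn_le; last exact: is_cvg_series_exp_coeff.
by apply: nondecreasing_series => k _ _; exact: exp_coeff_ge0.
Qed.

Lemma expmB_norm n (A B : 'M[R]_n) c : 1 <= c ->
  n%:R * `|A| <= c -> n%:R * `|B| <= c ->
  `|expm A - expm B| <= expR (2 * c) * n%:R * `|A - B|.
Proof.
move=> c1 Ac Bc.
have c0 : 0 <= c by rewrite (le_trans _ c1).
have AB := cvgB (@is_cvg_expm n A) (@is_cvg_expm n B).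
have cAB : `|series (fun k => k`!%:R^-1 *: A ^+ k) N
    - series (fun k => k`!%:R^-1 *: B ^+ k) N| @[N --> \oo]
    --> `|expm A - expm B| by exact: (cvg_norm (AB _)).
apply: (cvgr_to_le cAB).
near=> N.
rewrite /series /= -sumrB (le_trans (ler_norm_sum _ _ _))//.
apply: (@le_trans _ _ (series (exp_coeff (2 * c)) N * (n%:R * `|A - B|))).
  rewrite /series /= mulr_suml; apply: ler_sum => k _.
  rewrite -scalerBr normrZ ger0_norm ?invr_ge0// exp_coeffE /= -mulrA.
  by rewrite ler_wpM2l ?invr_ge0// expmxB_norm.
by rewrite -mulrA ler_wpM2r ?mulr_ge0// series_exp_coeff_le// mulr_ge0.
Unshelve. all: by end_near. Qed.

End MatrixNorm.

(** * Maps that are Lipschitz on bounded sets *)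

Section LipschitzOnBounded.
Variable R : realType.

(** The map f is Lipschitz on every ball centred at the origin. *)
Definition lip_bounded (V W : normedModType R) (f : V -> W) : Prop :=
  forall rho, exists2 L, 0 <= L &
    forall x y, `|x| <= rho -> `|y| <= rho -> `|f x - f y| <= L * `|x - y|.

Section General.
Variables V W : normedModType R.

Lemma lip_bounded_bound (f : V -> W) : lip_bounded f ->
  forall rho, exists2 M, 0 <= M & forall x, `|x| <= rho -> `|f x| <= M.
Proof.
move=> fL rho; have [L L0 fl] := fL rho.
exists (`|f 0| + L * `|rho|); first by rewrite addr_ge0// mulr_ge0.
move=> x xr; have r0 : 0 <= rho by rewrite (le_trans _ xr).
rewrite -[f x](subrK (f 0)) addrC (le_trans (ler_normD _ _))// lerD2l.
rewrite (le_trans (fl _ _ _ _))// ?normr0// subr0 ler_wpM2l// ger0_norm//.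
Qed.

Lemma lip_bounded_continuous (f : V -> W) : lip_bounded f -> continuous f.
Proof.
move=> fL x; have [L L0 fl] := fL (`|x| + 1).
apply/cvgrPdist_le => /= e e0; near=> y.
have yx : `|x - y| <= 1 by near: y; apply: cvgr_dist_le.
apply: (@le_trans _ _ (L * `|x - y|)).
  apply: fl; first by rewrite lerDl.
  rewrite -[y](subrK x) (le_trans (ler_normD _ _))// addrC lerD2l distrC//.
rewrite (@le_trans _ _ ((L + 1) * `|x - y|))// ?ler_wpM2r// ?lerDl//.
rewrite mulrC -ler_pdivlMr ?ltr_wpDl//.
near: y; apply: cvgr_dist_le => //; rewrite divr_gt0// ltr_wpDl//.
Unshelve. all: by end_near. Qed.

Lemma lip_bounded_cst (c : W) : lip_bounded (fun _ : V => c).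
Proof. by move=> rho; exists 0 => // x y _ _; rewrite subrr normr0 mul0r. Qed.

Lemma lip_boundedD (f g : V -> W) :
  lip_bounded f -> lip_bounded g -> lip_bounded (fun x => f x + g x).
Proof.
move=> fL gL rho; have [L L0 fl] := fL rho; have [M M0 gl] := gL rho.
exists (L + M); first exact: addr_ge0.
move=> x y xr yr; rewrite opprD addrACA (le_trans (ler_normD _ _))// mulrDl.
by rewrite lerD ?fl ?gl.
Qed.

Lemma lip_boundedN (f : V -> W) :
  lip_bounded f -> lip_bounded (fun x => - f x).
Proof.
move=> fL rho; have [L L0 fl] := fL rho; exists L => // x y xr yr.
by rewrite -opprD normrN fl.
Qed.

Lemma lip_bounded_sum (I : Type) (s : seq I) (f : I -> V -> W) :
  (forall i, lip_bounded (f i)) ->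
  lip_bounded (fun x => \sum_(i <- s) f i x).
Proof.
move=> fL; elim: s => [|i s IH].
  by under eq_fun do rewrite big_nil; exact: lip_bounded_cst.
by under eq_fun do rewrite big_cons; exact: lip_boundedD.
Qed.

End General.

Lemma lip_boundedZ (V W : normedModType R) (f : V -> R) (g : V -> W) :
  lip_bounded f -> lip_bounded g -> lip_bounded (fun x => f x *: g x).
Proof.
move=> fL gL rho; have [L L0 fl] := fL rho; have [M M0 gl] := gL rho.
have [bf bf0 fb] := lip_bounded_bound fL rho.
have [bg bg0 gb] := lip_bounded_bound gL rho.
exists (bf * M + L * bg); first by rewrite addr_ge0// mulr_ge0.
move=> x y xr yr.
have -> : f x *: g x - f y *: g y = f x *: (g x - g y) + (f x - f y) *: g y.
  by rewrite scalerBr scalerBl addrA subrK.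
rewrite (le_trans (ler_normD _ _))// mulrDl !normrZ lerD//.
  by rewrite -mulrA ler_pM ?fb ?gl.
by rewrite -mulrA [bg * _]mulrC mulrA ler_pM ?gb ?fl.
Qed.

Lemma lip_bounded_comp (V W Z : normedModType R) (g : W -> Z) (f : V -> W) :
  lip_bounded g -> lip_bounded f -> lip_bounded (g \o f).
Proof.
move=> gL fL rho; have [L L0 fl] := fL rho.
have [b b0 fb] := lip_bounded_bound fL rho.
have [M M0 gl] := gL b.
exists (M * L); first exact: mulr_ge0.
move=> x y xr yr /=; rewrite (le_trans (gl _ _ (fb _ xr) (fb _ yr)))//.
by rewrite -mulrA ler_wpM2l// fl.
Qed.

Lemma lip_bounded_id (V : normedModType R) : lip_bounded (fun x : V => x).
Proof. by move=> rho; exists 1 => // x y _ _; rewrite mul1r. Qed.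

Lemma lip_bounded_fst (V W : normedModType R) :
  lip_bounded (fun x : V * W => x.1).
Proof.
move=> rho; exists 1 => // x y _ _.
by rewrite mul1r [leRHS]prod_normE le_max lexx.
Qed.

Lemma lip_bounded_snd (V W : normedModType R) :
  lip_bounded (fun x : V * W => x.2).
Proof.
move=> rho; exists 1 => // x y _ _.
by rewrite mul1r [leRHS]prod_normE le_max lexx orbT.
Qed.

Section Matrices.
Variable V : normedModType R.

Lemma lip_bounded_coord m n (f : V -> 'M[R]_(m, n)) i j :
  lip_bounded f -> lip_bounded (fun x => f x i j : R).
Proof.
move=> fL rho; have [L L0 fl] := fL rho; exists L => // x y xr yr.
rewrite (le_trans _ (fl x y xr yr))//.
by have := coord_le_mx_norm (f x - f y) i j; rewrite !mxE.
Qed.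

Lemma lip_bounded_mx m n (f : V -> 'M[R]_(m, n)) :
  (forall i j, lip_bounded (fun x => f x i j : R)) -> lip_bounded f.
Proof.
move=> fL rho.
have /choice[L Ll] : forall ij : 'I_m * 'I_n, exists L, 0 <= L /\
    forall x y, `|x| <= rho -> `|y| <= rho ->
      `|f x ij.1 ij.2 - f y ij.1 ij.2| <= L * `|x - y|.
  by move=> [i j]; have [L L0 fl] := fL i j rho; exists L; split.
exists (\sum_ij L ij); first by apply: sumr_ge0 => ij _; case: (Ll ij).
move=> x y xr yr; apply: mx_norm_le => [|i j].
  by rewrite mulr_ge0// sumr_ge0// => ij _; case: (Ll ij).
have [_ /(_ x y xr yr) h] := Ll (i, j).
rewrite !mxE (le_trans h)// ler_wpM2r// (bigD1 (i, j))//= lerDl.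
by rewrite sumr_ge0// => ij _; case: (Ll ij).
Qed.

Lemma lip_bounded_mul m n p (f : V -> 'M[R]_(m, n)) (g : V -> 'M[R]_(n, p)) :
  lip_bounded f -> lip_bounded g -> lip_bounded (fun x => f x *m g x).
Proof.
move=> fL gL; apply: lip_bounded_mx => i j.
under eq_fun do rewrite mxE.
apply: lip_bounded_sum => k.
by apply: (@lip_boundedZ V R); exact: lip_bounded_coord.
Qed.

Lemma lip_bounded_tr m n (f : V -> 'M[R]_(m, n)) :
  lip_bounded f -> lip_bounded (fun x => (f x)^T).
Proof.
move=> fL; apply: lip_bounded_mx => i j.
by under eq_fun do rewrite mxE; exact: lip_bounded_coord.
Qed.

Lemma lip_bounded_expm n (f : V -> 'M[R]_n) :
  lip_bounded f -> lip_bounded (fun x => expm (f x)).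
Proof.
apply: lip_bounded_comp => rho.
exists (expR (2 * (1 + n%:R * `|rho|)) * n%:R).
  by rewrite mulr_ge0// expR_ge0.
move=> X Y Xr Yr; have r0 : 0 <= rho by rewrite (le_trans _ Xr).
apply: expmB_norm; first by rewrite lerDl mulr_ge0.
  by rewrite ler_wpDl// ler_wpM2l// (le_trans Xr)// ler_norm.
by rewrite ler_wpDl// ler_wpM2l// (le_trans Yr)// ler_norm.
Qed.

End Matrices.

End LipschitzOnBounded.

(** * The finite-horizon cost as a function of the gain *)

Section IntegralOfFiniteSum.
Context d (T : measurableType d) (R : realType).
Variables (mu : {measure set T -> \bar R}) (D : set T).
Hypothesis mD : measurable D.

Lemma integrable_sum_fun (I : Type) (s : seq I) (f : I -> T -> R) :
  (forall i, mu.-integrable D (EFin \o f i)) ->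
  mu.-integrable D (EFin \o (fun x => \sum_(i <- s) f i x)).
Proof.
move=> fi; elim: s => [|i s IH].
  rewrite (_ : EFin \o _ = cst 0%E); first exact: integrable0.
  by apply/funext => x /=; rewrite big_nil.
rewrite (_ : EFin \o _ = ((EFin \o f i) \+
    (EFin \o (fun x => (\sum_(i <- s) f i x)%R)))%E); first exact: integrableD.
by apply/funext => x /=; rewrite big_cons EFinD.
Qed.

Lemma Rintegral_sum (I : Type) (s : seq I) (f : I -> T -> R) :
  (forall i, mu.-integrable D (EFin \o f i)) ->
  \int[mu]_(x in D) (\sum_(i <- s) f i x) =
  \sum_(i <- s) \int[mu]_(x in D) f i x.
Proof.
move=> fi; elim: s => [|i s IH].
  rewrite big_nil -[RHS](mul0r (fine (mu D))) -Rintegral_cst//.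
  by apply: eq_Rintegral => x _; rewrite big_nil.
rewrite big_cons -IH -RintegralD//; last exact: integrable_sum_fun.
by apply: eq_Rintegral => x _; rewrite big_cons.
Qed.

Lemma integrableZ_fun (c : R) (f : T -> R) :
  mu.-integrable D (EFin \o f) ->
  mu.-integrable D (EFin \o (fun x => c * f x)).
Proof.
move=> fi; rewrite (_ : EFin \o _ = fun x => (c%:E * (f x)%:E)%E).
  exact: integrableZl.
by apply/funext => x /=; rewrite EFinM.
Qed.

End IntegralOfFiniteSum.

Section FiniteCost.
Variables (R : realType) (n m p : nat).
Variables (A : 'M[R]_n) (B : 'M[R]_(n, m)) (C : 'M[R]_(p, n)).
Variables (Q : 'M[R]_p) (Rw : 'M[R]_m).
Implicit Types (K : 'M[R]_(m, p)) (v x : 'cV[R]_n).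

(** The matrix of the quadratic form v |-> running_cost K v t. *)
Definition cost_mx K (t : R) : 'M[R]_n :=
  expm (t *: (closed_loop A B C K)^T) *m C^T *m (Q + K^T *m Rw *m K) *m C
    *m expm (t *: closed_loop A B C K).

(** The coefficients of the quadratic form v |-> finite_cost tau K v. *)
Definition int_cost_mx (tau : R) K k l : R :=
  \int[lebesgue_measure]_(t in `[0, tau]) cost_mx K t k l.

Lemma lip_bounded_cost_mx k l :
  lip_bounded (fun z : 'M[R]_(m, p) * R => cost_mx z.1 z.2 k l : R).
Proof.
have L1 := @lip_bounded_fst R ('M[R]_(m, p)) R.
have L2 := @lip_bounded_snd R ('M[R]_(m, p)) R.
have LA : lip_bounded (fun z : 'M[R]_(m, p) * R => closed_loop A B C z.1).
  apply: lip_boundedD; first exact: lip_bounded_cst.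
  apply: lip_boundedN; apply: lip_bounded_mul; last exact: lip_bounded_cst.
  by apply: lip_bounded_mul => //; exact: lip_bounded_cst.
apply: lip_bounded_coord; apply: lip_bounded_mul; last first.
  by apply: lip_bounded_expm; exact: lip_boundedZ.
apply: lip_bounded_mul; last exact: lip_bounded_cst.
apply: lip_bounded_mul.
  apply: lip_bounded_mul; last exact: lip_bounded_cst.
  by apply: lip_bounded_expm; apply: lip_boundedZ => //; exact: lip_bounded_tr.
apply: lip_boundedD; first exact: lip_bounded_cst.
apply: lip_bounded_mul => //; apply: lip_bounded_mul.
  exact: lip_bounded_tr.
exact: lip_bounded_cst.
Qed.

Lemma integrable_cost_mx (tau : R) K k l :
  lebesgue_measure.-integrable `[0, tau] (EFin \o (fun t => cost_mx K t k l)).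
Proof.
apply: continuous_compact_integrable; first exact: segment_compact.
apply: continuous_subspaceT.
apply: (@lip_bounded_continuous R R R).
have tL : lip_bounded (fun t : R => (K, t)).
  move=> rho; exists 1 => // x y _ _; rewrite mul1r prod_normE /= subrr normr0.
  by rewrite ge_max lexx normr_ge0.
exact: (lip_bounded_comp (lip_bounded_cost_mx k l) tL).
Qed.

Lemma lip_bounded_int_cost_mx (tau : R) k l : 0 <= tau ->
  lip_bounded (fun K => int_cost_mx tau K k l : R).
Proof.
move=> tau0 rho.
have [L L0 fl] := lip_bounded_cost_mx k l (Num.max rho tau).
exists (L * tau) => [|K K' Kr Kr']; first exact: mulr_ge0.
rewrite /int_cost_mx -RintegralB//; try exact: integrable_cost_mx.
have iB : lebesgue_measure.-integrable `[0, tau]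
    (EFin \o (fun t => cost_mx K t k l - cost_mx K' t k l)).
  rewrite (_ : EFin \o _ = ((EFin \o (fun t => cost_mx K t k l)) \-
     (EFin \o (fun t => cost_mx K' t k l)))%E).
    by apply: integrableB => //; exact: integrable_cost_mx.
  by apply/funext => t /=; rewrite EFinB.
rewrite (le_trans (le_normr_Rintegral _ _))//.
apply: (@le_trans _ _
    (\int[lebesgue_measure]_(t in `[0, tau]) (L * `|K - K'|))).
  apply: le_Rintegral => //.
  - by rewrite (_ : EFin \o _ = abse \o
      (EFin \o (fun t => cost_mx K t k l - cost_mx K' t k l)));
      [exact: integrable_abse|apply/funext].
  - apply: continuous_compact_integrable; first exact: segment_compact.
    by apply: continuous_subspaceT => t; exact: cvg_cst.
  move=> t /=; rewrite in_itv /= => /andP[t0 tt].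
  have h : `|t| <= Num.max rho tau by rewrite le_max ger0_norm// tt orbT.
  have KK : `|(K, t) - (K', t)| = `|K - K'|.
    by rewrite [LHS]prod_normE /= subrr normr0 max_l.
  rewrite -KK; apply: (fl (K, t) (K', t)).
    by rewrite [leLHS]prod_normE ge_max h le_max Kr.
  by rewrite [leLHS]prod_normE ge_max h le_max Kr'.
rewrite Rintegral_cst// (_ : fine _ = tau) 1?mulrAC//.
apply: (etrans (congr1 fine (lebesgue_measure_itv _))); rewrite /= lte_fin.
by move: tau0; rewrite le_eqVlt => /predU1P[<-|t0]; rewrite ?ltxx ?t0//= subr0.
Qed.

Lemma finite_costE (tau : R) K v :
  finite_cost A B C Q Rw tau K v =
  \sum_kl (v kl.1 ord0 * v kl.2 ord0) * int_cost_mx tau K kl.1 kl.2.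
Proof.
rewrite /finite_cost; under [RHS]eq_bigr => kl _.
  rewrite /int_cost_mx -RintegralZl//; last exact: integrable_cost_mx.
  over.
rewrite -Rintegral_sum//; last first.
  by move=> kl; apply: integrableZ_fun => //; exact: integrable_cost_mx.
apply: eq_Rintegral => t _; rewrite /running_cost.
rewrite (_ : v^T *m _ *m _ *m _ *m _ *m _ *m _ = v^T *m cost_mx K t *m v).
  rewrite mxE -(pair_bigA _ (fun k l =>
    v k ord0 * v l ord0 * cost_mx K t k l)) /= exchange_big /=.
  apply: eq_bigr => l _; rewrite mxE mulr_suml; apply: eq_bigr => k _.
  by rewrite mxE; ring.
by rewrite /cost_mx !mulmxA.
Qed.

Lemma lip_bounded_finite_cost (tau : R) v : 0 <= tau ->
  lip_bounded (fun K => finite_cost A B C Q Rw tau K v : R).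
Proof.
move=> tau0; under eq_fun do rewrite finite_costE.
apply: lip_bounded_sum => kl.
apply: (@lip_boundedZ _ _ R); first exact: lip_bounded_cst.
exact: lip_bounded_int_cost_mx.
Qed.

(** On bounded sets of gains and of initial states the cost is bounded. *)
Lemma finite_cost_bounded (tau rho sigma : R) : 0 <= tau ->
  exists M, forall K v, `|K| <= rho -> `|v| <= sigma ->
    `|finite_cost A B C Q Rw tau K v| <= M.
Proof.
move=> tau0.
have /choice[M Mb] : forall kl : 'I_n * 'I_n, exists M, forall K, `|K| <= rho ->
    `|int_cost_mx tau K kl.1 kl.2| <= M.
  move=> [k l].
  by have [M _ Mb] := lip_bounded_bound (lip_bounded_int_cost_mx k l tau0) rho;
    exists M.
exists (\sum_kl sigma * sigma * M kl) => K v Kr vs.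
rewrite finite_costE (le_trans (ler_norm_sum _ _ _))//.
apply: ler_sum => kl _; rewrite !normrM.
by rewrite !ler_pM// ?mulr_ge0// ?Mb// (le_trans (coord_le_mx_norm _ _ _)).
Qed.

End FiniteCost.

(** * Integrability on a probability space *)

Section Integrability.
Context d (T : measurableType d) (R : realType) (P : probability T R).
Implicit Types f g : T -> R.

Lemma ae_le_integrable f g : measurable_fun [set: T] f ->
  P.-integrable [set: T] (EFin \o g) ->
  {ae P, forall x, `|f x| <= `|g x|} ->
  P.-integrable [set: T] (EFin \o f).
Proof.
move=> mf /integrableP[mg ig] fg; apply/integrableP; split.
  exact/measurable_EFinP.
apply: le_lt_trans ig; apply: ae_ge0_le_integral => //.
- by apply: measurableT_comp => //; exact/measurable_EFinP.
- exact: measurableT_comp.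
- by apply: filterS fg => x fgx _ /=; rewrite lee_fin.
Qed.

Lemma integrable_cst_fun (c : R) : P.-integrable [set: T] (EFin \o (fun=> c)).
Proof. exact: finite_measure_integrable_cst. Qed.

Lemma ae_bounded_integrable f M : measurable_fun [set: T] f ->
  {ae P, forall x, `|f x| <= M} -> P.-integrable [set: T] (EFin \o f).
Proof.
move=> mf fM; apply: (ae_le_integrable mf (integrable_cst_fun M)).
by apply: filterS fM => x /le_trans; apply; rewrite ler_norm.
Qed.

(** Measurable with an integrable square. *)
Definition sq_integrable f : Prop :=
  measurable_fun [set: T] f /\
  P.-integrable [set: T] (EFin \o (fun x => f x ^+ 2)).

Lemma sq_integrableM f g : sq_integrable f -> sq_integrable g ->
  P.-integrable [set: T] (EFin \o (fun x => f x * g x)).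
Proof.
move=> [mf f2] [mg g2].
have fg2 : P.-integrable [set: T] (EFin \o (fun x => f x ^+ 2 + g x ^+ 2)).
  by rewrite (_ : EFin \o _ = ((EFin \o (fun x => (f x ^+ 2)%R)) \+
    (EFin \o (fun x => (g x ^+ 2)%R)))%E); [exact: integrableD|apply/funext].
apply: (ae_le_integrable _ fg2); first exact: measurable_funM.
apply: aeW => x; rewrite [leRHS]ger0_norm ?addr_ge0 ?sqr_ge0// normrM.
rewrite -[f x ^+ 2]real_normK ?num_real// -[g x ^+ 2]real_normK ?num_real//.
have := sqr_ge0 (`|f x| - `|g x|); have := normr_ge0 (f x).
by have := normr_ge0 (g x); nra.
Qed.

Lemma ae_bounded_sq_integrable f M : measurable_fun [set: T] f ->
  {ae P, forall x, `|f x| <= M} -> sq_integrable f.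
Proof.
move=> mf fM; split=> //; apply: (@ae_bounded_integrable _ (M ^+ 2)).
  exact: measurable_funX.
by apply: filterS fM => x fx; rewrite normrX lerXn2r// nnegrE (le_trans _ fx).
Qed.

Lemma sq_integrable_cst c : sq_integrable (fun=> c).
Proof.
by apply: (@ae_bounded_sq_integrable _ `|c|) => //; apply: aeW.
Qed.

Lemma sq_integrable_integrable f : sq_integrable f ->
  P.-integrable [set: T] (EFin \o f).
Proof.
move=> /(sq_integrableM (sq_integrable_cst 1)).
by under [fun x => 1 * f x]eq_fun do rewrite mul1r.
Qed.

Lemma sq_integrableD f g : sq_integrable f -> sq_integrable g ->
  sq_integrable (fun x => f x + g x).
Proof.
move=> f2 g2; split; first by apply: measurable_funD; [case: f2|case: g2].
rewrite (_ : EFin \o _ = ((EFin \o (fun x => (f x ^+ 2)%R)) \+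
  ((EFin \o (fun x => (g x ^+ 2)%R)) \+
    (EFin \o (fun x => (2 * (f x * g x))%R))))%E); last first.
  by apply/funext => x /=; rewrite -!EFinD; congr EFin; ring.
apply: integrableD => //; first by case: f2.
apply: integrableD => //; first by case: g2.
by apply: integrableZ_fun => //; exact: sq_integrableM.
Qed.

Lemma sq_integrableZ c f : sq_integrable f -> sq_integrable (fun x => c * f x).
Proof.
move=> [mf f2]; split; first by apply: measurable_funM => //.
under [fun x => _ ^+ 2]eq_fun do rewrite exprMn.
exact: integrableZ_fun.
Qed.

Lemma sq_integrableB f g : sq_integrable f -> sq_integrable g ->
  sq_integrable (fun x => f x - g x).
Proof.
move=> f2 /(sq_integrableZ (-1)) g2.
by under eq_fun do rewrite -mulN1r; exact: sq_integrableD.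
Qed.

Lemma sq_integrable_sum (I : Type) (s : seq I) (f : I -> T -> R) :
  (forall i, sq_integrable (f i)) ->
  sq_integrable (fun x => \sum_(i <- s) f i x).
Proof.
move=> f2; elim: s => [|i s IH].
  by under eq_fun do rewrite big_nil; exact: sq_integrable_cst.
by under eq_fun do rewrite big_cons; exact: sq_integrableD.
Qed.

Lemma sq_integrable_ae_boundedM f g M : measurable_fun [set: T] f ->
  {ae P, forall x, `|f x| <= M} -> sq_integrable g ->
  sq_integrable (fun x => f x * g x).
Proof.
move=> mf fM [mg g2]; split; first exact: measurable_funM.
apply: (@ae_le_integrable _ (fun x => M ^+ 2 * g x ^+ 2)).
- by apply: measurable_funX; exact: measurable_funM.
- exact: integrableZ_fun.
apply: filterS fM => x fx; rewrite exprMn normrM [leRHS]normrM ler_wpM2r//.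
by rewrite !normrX lerXn2r ?nnegrE// (le_trans fx)// ler_norm.
Qed.

End Integrability.

Lemma ae_bounded_Rintegral d (T : measurableType d) (R : realType)
    (P : probability T R) (f : T -> R) M : measurable_fun [set: T] f ->
  {ae P, forall x, `|f x| <= M} -> `|\int[P]_x f x| <= M.
Proof.
move=> mf fM; have fi := ae_bounded_integrable mf fM.
rewrite -lee_fin EFin_normr_Rintegral//.
rewrite (le_trans (le_abse_integral _ _ _))//.
  exact/measurable_EFinP.
have M0 : 0 <= M.
  apply: contrapT => /negP; rewrite -ltNge => M0.
  have : P [set: T] = 0%E.
    apply/(@negligibleP _ _ _ P) => //.
    case: fM => A [mA PA fA]; exists A; split => // x _; apply: fA => /=.
    by apply/negP; rewrite -ltNge (lt_le_trans M0).
  by move/eqP; rewrite probability_setT onee_eq0.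
apply: (@le_trans _ _ (\int[P]_x (M%:E))%E).
  apply: ae_ge0_le_integral => //.
    by apply: measurableT_comp => //; exact/measurable_EFinP.
  by apply: filterS fM => x fx _ /=; rewrite lee_fin.
rewrite integral_cst//.
rewrite -[leRHS]mule1; apply: lee_wpmul2l; first by rewrite lee_fin.
exact: probability_le1.
Qed.

(** * Consequences of independence *)

Section Independence.
Context d (T : measurableType d) (R : realType) (P : probability T R).
Context d1 d2 (T1 : measurableType d1) (T2 : measurableType d2).

Section Pairing.
Variables (Y1 : T -> T1) (Y2 : T -> T2).
Hypothesis mY1 : measurable_fun [set: T] Y1.
Hypothesis mY2 : measurable_fun [set: T] Y2.

Let mY : measurable_fun [set: T] (fun w => (Y1 w, Y2 w)).
Proof. exact: measurable_fun_pair. Qed.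

(** An event that is independent of all the events {Y1 in A, Y2 in B} is
    independent of the random pair (Y1, Y2): such events form a pi-system. *)
Lemma pair_indep_event (E : set T) : measurable E ->
  (forall A B, measurable A -> measurable B ->
     P (Y1 @^-1` A `&` Y2 @^-1` B `&` E) =
     (P (Y1 @^-1` A `&` Y2 @^-1` B) * P E)%E) ->
  forall W : set (T1 * T2), measurable W ->
    P ((fun w => (Y1 w, Y2 w)) @^-1` W `&` E) =
    (P ((fun w => (Y1 w, Y2 w)) @^-1` W) * P E)%E.
Proof.
move=> mE indE W mW.
pose Y : {mfun T >-> (T1 * T2)%type} := mfun_Sub (mem_set mY).
have PE0 : 0 <= fine (P E) by rewrite fine_ge0.
pose m1 : {measure set (T1 * T2) -> \bar R} :=
  pushforward (mrestr P mE) Y.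
pose m2 : {measure set (T1 * T2) -> \bar R} :=
  mscale (NngNum PE0) (pushforward P Y).
have mYY : measurable_fun [set: T] Y := mY.
suff : m1 mYY W = m2 mYY W.
  rewrite /m1 /m2 /= /mscale /pushforward /mrestr /= fineK ?fin_num_measure//.
  by rewrite muleC => <-.
pose G : set (set (T1 * T2)) :=
  [set A `*` B | A in measurable & B in measurable].
apply: (measure_unique G (fun=> setT)) => //.
- by rewrite measurable_prod_measurableType.
- move=> _ _ [A mA [B mB <-]] [A' mA' [B' mB' <-]].
  exists (A `&` A'); first exact: measurableI.
  by exists (B `&` B'); [exact: measurableI|rewrite setXI].
- by move=> _; exists setT => //; exists setT => //; rewrite setXTT.
- by rewrite bigcup_const//; exists 0%N.
- move=> _ [A mA [B mB <-]].
  rewrite /m1 /m2 /= /mscale /pushforward /mrestr /= fineK ?fin_num_measure//.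
  by rewrite muleC -indE.
- move=> _; rewrite /m1 /= /pushforward /mrestr /= preimage_setT setTI.
  by rewrite (le_lt_trans (probability_le1 _ _))// ltry.
Qed.

End Pairing.

(** Fubini's theorem for an independent pair, in the form: a function of
    (Y1, Y2) whose mean over Y1 vanishes for every value of Y2 has mean 0. *)
Lemma indep_integral0 (S : probability T1 R) (Y1 : {mfun T >-> T1})
    (Y2 : {mfun T >-> T2}) (phi : T1 * T2 -> R) :
  (forall A B, measurable A -> measurable B ->
     P (Y1 @^-1` A `&` Y2 @^-1` B) = (S A * P (Y2 @^-1` B))%E) ->
  measurable_fun [set: T1 * T2] phi ->
  P.-integrable [set: T] (EFin \o (fun w => phi (Y1 w, Y2 w))) ->
  (forall y, (\int[S]_x (phi (x, y))%:E = 0)%E) ->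
  \int[P]_w (phi (Y1 w, Y2 w)) = 0.
Proof.
move=> ind mphi iphi phi0.
have mY : measurable_fun [set: T] (fun w => (Y1 w, Y2 w)).
  exact: measurable_fun_pair.
pose Y : {mfun T >-> (T1 * T2)%type} := mfun_Sub (mem_set mY).
pose m' : {measure set (T1 * T2) -> \bar R} := distribution P Y.
have law : forall W : set (T1 * T2), measurable W ->
    (S \x (distribution P Y2))%E W = m' W.
  by apply: product_measure_unique => A B mA mB; exact: ind.
have mphiE : measurable_fun [set: T1 * T2] (EFin \o phi).
  exact/measurable_EFinP.
rewrite /Rintegral.
have -> : (\int[P]_w (phi (Y1 w, Y2 w))%:E =
    \int[S \x (distribution P Y2)]_z (phi z)%:E)%E.
  rewrite (eq_measure_integral m') => [|W mW _]; last exact: law.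
  by rewrite (integral_distribution mphiE).
have iprod : (S \x (distribution P Y2))%E.-integrable setT (EFin \o phi).
  apply/integrableP; split => //.
  rewrite (eq_measure_integral m') => [|W mW _]; last exact: law.
  have : m'.-integrable setT (EFin \o phi) by exact: integrable_pushforward.
  by move=> /integrableP[].
have iprod2 : (S \x (distribution P Y2))%E.-integrable setT
  (fun z => (phi z)%:E) := iprod.
rewrite -(integral21_prod_meas1 iprod2) /fubini_G.
by rewrite integral0_eq// => y _; exact: phi0.
Qed.

(** Integration over an event that is independent of Y. *)
Lemma indep_event_integral (D : probability T2 R) (Y : {mfun T >-> T2})
    (E : set T) (f : T2 -> \bar R) : measurable E ->
  (forall A, measurable A -> P (Y @^-1` A `&` E) = (D A * P E)%E) ->
  measurable_fun [set: T2] f -> (forall y, (0 <= f y)%E) ->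
  (\int[P]_(w in E) f (Y w) = P E * \int[D]_y f y)%E.
Proof.
move=> mE ind mf f0.
have PE0 : 0 <= fine (P E) by rewrite fine_ge0.
pose Q : {measure set T -> \bar R} := mrestr P mE.
have mfY : measurable_fun [set: T] (f \o Y) by exact: measurableT_comp.
transitivity (\int[Q]_(w in E) f (Y w))%E.
  by apply: eq_measure_integral => A mA AE; rewrite /Q /= /mrestr setIidl.
transitivity (\int[Q]_w f (Y w))%E.
  rewrite [RHS](@ge0_negligible_integral _ _ _ _ _ (~` E))//.
  - by rewrite setTD setCK.
  - exact: measurableC.
  - by rewrite /Q /= /mrestr setICl measure0.
transitivity (\int[pushforward Q Y]_y f y)%E.
  by rewrite ge0_integral_pushforward// => y _; exact: f0.
rewrite (eq_measure_integral (mscale (NngNum PE0) D)) => [|A mA _].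
  by rewrite ge0_integral_mscale//= fineK// fin_num_measure.
rewrite [RHS]/= /mscale /= fineK ?fin_num_measure// [RHS]muleC; exact: ind.
Qed.

End Independence.

(** * Estimators built from independent samples *)

Section Samples.
Context d (T : measurableType d) (R : realType) (P : probability T R).
Context d1 d2 (T1 : measurableType d1) (T2 : measurableType d2).
Variables (S : probability T1 R) (D : probability T2 R) (N : nat).
Variables (U : 'I_N -> {RV P >-> T1}) (X : 'I_N -> {RV P >-> T2}).
Hypothesis hU : forall i E, measurable E -> distribution P (U i) E = S E.
Hypothesis hX : forall i E, measurable E -> distribution P (X i) E = D E.
Hypothesis hindep : mutually_independent P
  (fun k : 'I_N + 'I_N =>
     match k with inl i => sigma_of (U i) | inr i => sigma_of (X i) end).

(** The joint law of all the samples is a product law. *)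
Lemma samples_law (AU : 'I_N -> set T1) (AX : 'I_N -> set T2) :
  (forall i, measurable (AU i)) -> (forall i, measurable (AX i)) ->
  P [set w | forall i, AU i (U i w) /\ AX i (X i w)] =
  ((\prod_i S (AU i)) * (\prod_i D (AX i)))%E.
Proof.
move=> mAU mAX.
pose E (k : 'I_N + 'I_N) : set T :=
  match k with inl i => U i @^-1` AU i | inr i => X i @^-1` AX i end.
have := hindep (J := [set: 'I_N + 'I_N]%SET) (E := E).
rewrite (_ : \bigcap_(i in _) _ =
    [set w | forall i, AU i (U i w) /\ AX i (X i w)]); last first.
  apply/seteqP; split=> w /=.
    move=> Ew i; have := Ew (inl i); have := Ew (inr i).
    by rewrite /= !inE => h1 h2; split; [exact: h2|exact: h1].
  by move=> Ew [i|i] _ /=; case: (Ew i).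
move=> ->.
  rewrite (eq_bigl xpredT) => [|k]; last by rewrite inE.
  rewrite big_sumType /=; congr (_ * _)%E; apply: eq_bigr => i _.
    exact: hU.
  exact: hX.
by move=> [i|i] _ /=; [exists (AU i)|exists (AX i)]; rewrite ?setTI.
Qed.

Let prod_if d' (T' : measurableType d') (m : probability T' R) i (A : set T') :
  (\prod_(j < N) m (if j == i then A else setT) = m A)%E.
Proof.
rewrite (bigD1 i)//= eqxx big1 ?mule1// => j /negbTE ->.
by rewrite probability_setT.
Qed.

Let prod_if2 d' (T' : measurableType d') (m : probability T' R) i j
    (A B : set T') : i != j ->
  (\prod_(k < N) m (if k == i then A else if k == j then B else setT) =
   m A * m B)%E.
Proof.
move=> ij; rewrite (bigD1 i)//= eqxx (bigD1 j)/=; last by rewrite eq_sym.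
rewrite eq_sym (negbTE ij) eqxx big1 ?mule1// => k /andP[/negbTE -> /negbTE ->].
by rewrite probability_setT.
Qed.

Lemma indep_sample i A B : measurable A -> measurable B ->
  P (U i @^-1` A `&` X i @^-1` B) = (S A * D B)%E.
Proof.
move=> mA mB.
rewrite -(prod_if S i A) -(prod_if D i B) -samples_law => [|j|j].
- congr (P _); apply/seteqP; split=> w /=.
    by move=> [Aw Bw] j; case: eqP => // ->.
  by move/(_ i); rewrite eqxx.
- by case: ifP.
- by case: ifP.
Qed.

Let indep_two_samples i j A B A' B' : i != j ->
  measurable A -> measurable B -> measurable A' -> measurable B' ->
  P (U i @^-1` A `&` X i @^-1` B `&` (X j @^-1` B' `&` U j @^-1` A')) =
  ((S A * D B) * (D B' * S A'))%E.
Proof.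
move=> ij mA mB mA' mB'.
rewrite [(D B' * _)%E]muleC muleACA -(prod_if2 S A A' ij) -(prod_if2 D B B' ij).
rewrite -samples_law => [|k|k].
- congr (P _); apply/seteqP; split=> w /=.
    move=> [[Aw Bw] [Bw' Aw']] k.
    by case: eqP => [->//|_]; case: eqP => [->//|_].
  move=> Ew; have := Ew i; have := Ew j.
  by rewrite !eqxx [j == i]eq_sym (negbTE ij) => -[? ?] [].
- by case: ifP => // _; case: ifP.
- by case: ifP => // _; case: ifP.
Qed.

(** The direction of one sample is independent of another sample together
    with its own initial state. *)
Lemma indep_cross i j A (W : set ((T1 * T2) * T2)) : i != j ->
  measurable A -> measurable W ->
  P (U j @^-1` A `&` (fun w => ((U i w, X i w), X j w)) @^-1` W) =
  (S A * P ((fun w => ((U i w, X i w), X j w)) @^-1` W))%E.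
Proof.
move=> ij mA mW.
have mUj E : measurable E -> measurable (U j @^-1` E).
  by move=> mE; exact: measurable_funPTI.
have mXj E : measurable E -> measurable (X j @^-1` E).
  by move=> mE; exact: measurable_funPTI.
have mV : measurable_fun [set: T] (fun w => (U i w, X i w)).
  exact: measurable_fun_pair.
have first_pair V B A' : measurable V -> measurable B -> measurable A' ->
    P ((fun w => (U i w, X i w)) @^-1` V `&` (X j @^-1` B `&` U j @^-1` A')) =
    (P ((fun w => (U i w, X i w)) @^-1` V) * (D B * S A'))%E.
  move=> mVV mB mA'.
  have jE : P (X j @^-1` B `&` U j @^-1` A') = (D B * S A')%E.
    by rewrite setIC indep_sample// muleC.
  rewrite -jE; apply: pair_indep_event => //.
    by apply: measurableI; [exact: mXj|exact: mUj].
  by move=> A1 B1 mA1 mB1; rewrite jE indep_two_samples// indep_sample.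
have S_A : P (U j @^-1` A) = S A by exact: hU.
rewrite setIC muleC -S_A; apply: pair_indep_event => //; first exact: mUj.
move=> V B mVV mB; rewrite -setIA first_pair// S_A muleA; congr (_ * _)%E.
have := first_pair V B setT mVV mB measurableT.
by rewrite preimage_setT setIT probability_setT mule1.
Qed.

Lemma ae_sample1 i (Q : set T1) : {ae S, forall x, Q x} ->
  {ae P, forall w, Q (U i w)}.
Proof.
move=> [E [mE SE QE]]; exists (U i @^-1` E); split.
- exact: measurable_funPTI.
- by rewrite -SE -(hU i mE).
- by move=> w /= nQ; exact: QE.
Qed.

Lemma ae_sample2 i (Q : set T2) : {ae D, forall x, Q x} ->
  {ae P, forall w, Q (X i w)}.
Proof.
move=> [E [mE SE QE]]; exists (X i @^-1` E); split.
- exact: measurable_funPTI.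
- by rewrite -SE -(hX i mE).
- by move=> w /= nQ; exact: QE.
Qed.

(* The directions u(U_i) have coordinates u_k, constant squared norm c and mean
    zero. *)
Section Baseline.
Variables (I : finType) (u : I -> T1 -> R) (c : R).
Hypothesis mu : forall k, measurable_fun [set: T1] (u k).
Hypothesis c_gt0 : 0 < c.
Hypothesis u_sphere : {ae S, forall x, \sum_k u k x ^+ 2 = c}.
Hypothesis u_mean : forall k, (\int[S]_x (u k x)%:E = 0)%E.

Let u_le x k : \sum_k u k x ^+ 2 = c -> `|u k x| <= 1 + c.
Proof.
move=> ux; have h : u k x ^+ 2 <= c.
  by rewrite -ux (bigD1 k)//= lerDl sumr_ge0// => j _; rewrite sqr_ge0.
rewrite -[u k x ^+ 2]real_normK ?num_real// in h.
by have := normr_ge0 (u k x); move: h c_gt0; nra.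
Qed.

Let u_bounded k : {ae S, forall x, `|u k x| <= 1 + c}.
Proof. by apply: filterS u_sphere => x; exact: u_le. Qed.

Let u_integrable k : S.-integrable [set: T1] (EFin \o u k).
Proof. exact: ae_bounded_integrable (u_bounded k). Qed.

Let measurable_norm_le (h : T2 -> R) r : measurable_fun [set: T2] h ->
  measurable [set y | `|h y| <= r].
Proof.
move=> mh; have mn : measurable_fun [set: T2] (Num.norm \o h).
  exact: measurableT_comp.
rewrite (_ : [set y | _] =
  [set: T2] `&` (Num.norm \o h) @^-1` `]-oo, r]%classic).
  by apply: mn.
by rewrite setTI; apply/seteqP; split=> y; rewrite /= in_itv.
Qed.

Section WeightedDirections.
Variable h : T2 -> R.
Hypothesis mh : measurable_fun [set: T2] h.

Let mhX i : measurable_fun [set: T] (fun w => h (X i w)).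
Proof. exact: measurableT_comp. Qed.

Let muU k i : measurable_fun [set: T] (fun w => u k (U i w)).
Proof. exact: measurableT_comp. Qed.

(* The sets {|h| <= m} cover T2, so they are not all negligible. *)
Let level_gt0 : exists m : nat, (0 < D [set y | (`|h y| <= m%:R)%R])%E.
Proof.
apply: contrapT => nm.
have Dm m : D.-negligible [set y | `|h y| <= m%:R].
  exists [set y | `|h y| <= m%:R]; split => //; first exact: measurable_norm_le.
  apply/eqP; rewrite eq_le measure_ge0 andbT leNgt; apply/negP => Dm.
  by apply: nm; exists m.
have := negligible_bigcup Dm.
rewrite (_ : \bigcup_k _ = setT).
  rewrite negligibleP// => /eqP; rewrite -[X in X == _]/(D setT).
  by rewrite probability_setT onee_eq0.
apply/seteqP; split=> // y _; exists (Num.truncn `|h y|).+1 => //=.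
by rewrite ltW// truncnS_gt.
Qed.

(** If the sum over the samples of the weighted directions h(X_i) U_i has
    square integrable coordinates, then every weight h(X_i) is square
    integrable.  On the event that the other weights are bounded, which has
    positive probability and is independent of X_i, the weight h(X_i) is
    controlled by the sum. *)
Lemma weight_sq_integrable i :
  (forall k, sq_integrable P (fun w => \sum_j h (X j w) * u k (U j w))) ->
  sq_integrable P (fun w => h (X i w)).
Proof.
move=> W2; split => //.
have [m Dm] := level_gt0.
pose Am : set T2 := [set y | `|h y| <= m%:R].
have mAm : measurable Am by exact: measurable_norm_le.
pose G := [set w | forall j, j != i -> Am (X j w)].
pose AX A j := if j == i then A else Am.
have GE A : X i @^-1` A `&` G =
    [set w | forall j, [set: T1] (U j w) /\ AX A j (X j w)].
  apply/seteqP; split=> w /=.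
    by move=> [Aw Gw] j; split=> //; rewrite /AX; case: eqP => [->//|/eqP/Gw].
  rewrite /AX => Ew; split; first by have [] := Ew i; rewrite eqxx.
  by move=> j ji; have [] := Ew j; rewrite (negbTE ji).
have mG : measurable G.
  rewrite -[G]setTI -[X in X `&` _](preimage_setT (X i)) GE.
  rewrite (_ : [set _ | _] = \bigcap_(j : 'I_N) X j @^-1` AX setT j).
    apply: fin_bigcap_measurable => // j _; apply: measurable_funPTI.
    by rewrite /AX; case: ifP.
  apply/seteqP; split=> w /=; first by move=> Ew j _; case: (Ew j).
  by move=> Ew j; split=> //; exact: Ew.
pose q := (\prod_(j < N | j != i) D Am)%E.
have PE A : measurable A -> P (X i @^-1` A `&` G) = (D A * q)%E.
  move=> mA; rewrite GE (samples_law (AU := fun=> setT)) => [||j]//.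
    rewrite big1 ?mul1e; last by move=> j _; rewrite probability_setT.
    rewrite (bigD1 i)//= {1}/AX eqxx; congr (_ * _)%E.
    by apply: eq_bigr => j /negbTE ji; rewrite /AX ji.
  by rewrite /AX; case: ifP.
have PG : P G = q.
  by rewrite -[G]setTI -(preimage_setT (X i)) PE// probability_setT mul1e.
have q_gt0 : (0 < q)%E.
  by rewrite /q; elim/big_ind: _ => // x y; exact: mule_gt0.
have indG A : measurable A -> P (X i @^-1` A `&` G) = (D A * P G)%E.
  by move=> mA; rewrite PG PE.
pose f y := (h y ^+ 2)%:E.
have mf : measurable_fun [set: T2] f.
  by apply/measurable_EFinP; exact: measurable_funX.
have f0 y : (0 <= f y)%E by rewrite lee_fin sqr_ge0.
have intG := indep_event_integral mG indG mf f0.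
(* Bound on the coordinates of the sum of the weighted directions of the other
   samples, on the event G. *)
pose b := (N * m)%:R * (1 + c).
pose V w := \sum_k (2 * (\sum_j h (X j w) * u k (U j w)) ^+ 2 + 2 * b ^+ 2).
have iV : P.-integrable [set: T] (EFin \o V).
  apply: integrable_sum_fun => // k.
  rewrite (_ : EFin \o _ = ((EFin \o (fun w => (2 * (\sum_j h (X j w) *
    u k (U j w)) ^+ 2)%R)) \+ (EFin \o (fun=> (2 * b ^+ 2)%R)))%E).
    apply: integrableD => //; last exact: integrable_cst_fun.
    by apply: integrableZ_fun => //; case: (W2 k).
  by apply/funext.
have V0 w : 0 <= V w.
  by apply: sumr_ge0 => k _; rewrite addr_ge0// mulr_ge0// sqr_ge0.
(* With x the i-th term, s the whole sum and r := s - x the other terms,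
   x ^ 2 <= 2 s ^ 2 + 2 r ^ 2. *)
have VG : {ae P, forall w, G w -> (c%:E * f (X i w) <= (V w)%:E)%E}.
  have : {ae P, forall w, forall j, \sum_k u k (U j w) ^+ 2 = c}.
    apply: filter_forall => j.
    exact: (@ae_sample1 j [set x | \sum_k u k x ^+ 2 = c]).
  apply: filterS => w uw Gw.
  rewrite /f -EFinM lee_fin -{1}(uw i) mulr_suml; apply: ler_sum => k _.
  rewrite (bigD1 i)//=; set r := \sum_(j < N | _) _.
  have rb : `|r| <= b.
    rewrite (le_trans (ler_norm_sum _ _ _))//.
    rewrite (@le_trans _ _ (\sum_(j < N) m%:R * (1 + c)))//.
      rewrite [leRHS](bigD1 i)//= ler_wpDl//.
        by rewrite mulr_ge0// addr_ge0// ltW.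
      apply: ler_sum => j ji; rewrite normrM ler_pM//; first exact: Gw.
      exact: u_le.
    by rewrite sumr_const card_ord /b natrM -mulrA [leRHS]mulr_natl.
  have r2 : r ^+ 2 <= b ^+ 2.
    by rewrite -[r ^+ 2]real_normK ?num_real// lerXn2r// nnegrE (le_trans _ rb).
  have := sqr_ge0 (h (X i w) * u k (U i w) + 2 * r); nra.
have fin : (\int[D]_y f y < +oo)%E.
  have : (c%:E * (q * \int[D]_y f y) < +oo)%E.
    rewrite -PG -intG -ge0_integralZl//; last 2 first.
      by apply: measurable_funTS; exact: measurableT_comp.
      exact: ltW.
    apply: (@le_lt_trans _ _ (\int[P]_w (V w)%:E)%E); last first.
      have /integrableP[_] := iV.
      by under eq_integral do rewrite gee0_abs ?lee_fin//.
    have mV : measurable_fun [set: T] (EFin \o V) by case/integrableP: iV.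
    apply: (@le_trans _ _ (\int[P]_(w in G) (V w)%:E)%E).
      apply: ae_ge0_le_integral => //.
      - by move=> w _; rewrite mule_ge0// lee_fin ltW.
      - apply: measurable_funTS; apply: measurable_funeM.
        exact: measurableT_comp.
      - by move=> w _; rewrite lee_fin.
      - exact: measurable_funTS.
    by apply: ge0_subset_integral => // w _; rewrite lee_fin.
  rewrite !ltey; apply: contraNN => /eqP ->.
  by rewrite gt0_muley// gt0_muley// lte_fin.
apply/integrableP; split.
  by apply/measurable_EFinP; exact: measurable_funX.
under eq_integral do rewrite gee0_abs ?lee_fin ?sqr_ge0//.
apply: le_lt_trans fin.
rewrite (eq_measure_integral (distribution P (X i))) => [|A mA _].
  by rewrite (ge0_integral_distribution (X i) mf f0).
exact/esym/hX.
Qed.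

End WeightedDirections.

Let integral0Z (g : T1 -> R) r : S.-integrable [set: T1] (EFin \o g) ->
  (\int[S]_x (g x)%:E = 0)%E -> (\int[S]_x (r * g x)%:E = 0)%E.
Proof.
move=> ig g0; under eq_integral do rewrite EFinM.
by rewrite integralZl// g0 mule0.
Qed.

(* The map b0 is the mean of F over the directions. *)
Variables (F : T1 * T2 -> R) (b0 : T2 -> R) (M : R).
Hypothesis mF : measurable_fun [set: T1 * T2] F.
Hypothesis F_integrable : forall y,
  S.-integrable [set: T1] (EFin \o (fun x => F (x, y))).
Hypothesis F_mean : forall y, (\int[S]_x (F (x, y))%:E = (b0 y)%:E)%E.
Hypothesis mb0 : measurable_fun [set: T2] b0.
Hypothesis F_bounded : forall i, {ae P, forall w, `|F (U i w, X i w)| <= M}.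
Hypothesis b0_bounded : {ae D, forall y, `|b0 y| <= M}.

(* The deviation of F from its mean, for the i-th sample. *)
Let Phi i w := F (U i w, X i w) - b0 (X i w).

Let mPhi i : measurable_fun [set: T] (Phi i).
Proof.
apply: measurable_funB; last exact: measurableT_comp.
apply: (measurableT_comp mF); exact: measurable_fun_pair.
Qed.

Let Phi_bounded i : {ae P, forall w, `|Phi i w| <= M + M}.
Proof.
apply: filterS2 (F_bounded i) (ae_sample2 i b0_bounded) => w Fw bw.
by rewrite (le_trans (ler_normB _ _))// lerD.
Qed.

Let centered y : (\int[S]_x (F (x, y) - b0 y)%:E = 0)%E.
Proof.
under eq_integral do rewrite EFinB.
rewrite integralB//; [|exact: F_integrable|exact: integrable_cst_fun].
rewrite F_mean (_ : \int[S]_x _ = (b0 y)%:E)%E ?subee//.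
rewrite integral_cst//.
by apply: (etrans (congr1 (mule _) (probability_setT S))); rewrite mule1.
Qed.

Let centered_integrable y :
  S.-integrable [set: T1] (EFin \o (fun x => F (x, y) - b0 y)).
Proof.
rewrite (_ : EFin \o _ =
  ((EFin \o (fun x => F (x, y))) \- (EFin \o (fun=> b0 y)))%E).
  by apply: integrableB => //; exact: integrable_cst_fun.
by apply/funext => x /=; rewrite EFinB.
Qed.

Section Perturbation.
Variable h : T2 -> R.
Hypothesis mh : measurable_fun [set: T2] h.
Hypothesis h2 : forall i, sq_integrable P (fun w => h (X i w)).

Let muU k i : measurable_fun [set: T] (fun w => u k (U i w)).
Proof. exact: measurableT_comp. Qed.

Lemma hu_sq_integrable i k :
  sq_integrable P (fun w => h (X i w) * u k (U i w)).
Proof.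
under eq_fun do rewrite mulrC.
by apply: (sq_integrable_ae_boundedM _ (ae_sample1 i (u_bounded k))).
Qed.

Lemma Phiu_sq_integrable i k : sq_integrable P (fun w => Phi i w * u k (U i w)).
Proof.
apply: (sq_integrable_ae_boundedM _ (Phi_bounded i)) => //.
exact: (ae_bounded_sq_integrable _ (ae_sample1 i (u_bounded k))).
Qed.

Lemma mean_hu i k : \int[P]_w (h (X i w) * u k (U i w)) = 0.
Proof.
apply: (@indep_integral0 _ _ _ P _ _ _ _ S (U i) (X i)
  (fun z => h z.2 * u k z.1)) => /=.
- move=> A B mA mB; rewrite indep_sample//; congr (_ * _)%E.
  exact/esym/hX.
- apply: measurable_funM; first exact: measurableT_comp.
  exact: measurableT_comp.
- exact/sq_integrable_integrable/hu_sq_integrable.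
- by move=> y; exact: integral0Z.
Qed.

(** Within one sample the squared norm of the direction is the constant c, which
    leaves a multiple of Phi_i h(X_i). *)
Lemma mean_Phiu_hu_diag i :
  \int[P]_w (\sum_k (Phi i w * u k (U i w)) * (h (X i w) * u k (U i w))) = 0.
Proof.
have Phih : sq_integrable P (Phi i).
  exact: (ae_bounded_sq_integrable _ (Phi_bounded i)).
have iPh := sq_integrableM Phih (h2 i).
transitivity (\int[P]_w ((F (U i w, X i w) - b0 (X i w)) * (c * h (X i w)))).
  rewrite /Rintegral; congr fine; apply: ae_eq_integral => //.
  - apply/measurable_EFinP; apply: measurable_sum => k.
    by apply: measurable_funM; apply: measurable_funM => //;
      exact: measurableT_comp.
  - apply/measurable_EFinP; apply: (measurable_funM (mPhi i)).
    by apply: measurable_funM => //; exact: measurableT_comp.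
  apply: filterS (ae_sample1 i u_sphere) => w uw _ /=; congr EFin.
  rewrite -uw mulr_suml mulr_sumr; apply: eq_bigr => k _; rewrite /Phi; ring.
apply: (@indep_integral0 _ _ _ P _ _ _ _ S (U i) (X i)
  (fun z => (F z - b0 z.2) * (c * h z.2))) => /=.
- move=> A B mA mB; rewrite indep_sample//; congr (_ * _)%E.
  exact/esym/hX.
- apply: measurable_funM.
    by apply: measurable_funB => //; exact: measurableT_comp.
  by apply: measurable_funM => //; exact: measurableT_comp.
- under [fun w => (_ - _) * _]eq_fun do rewrite mulrCA.
  exact: integrableZ_fun.
- move=> y; under eq_integral do rewrite mulrC.
  exact: integral0Z.
Qed.

(** For two samples, integrate first over the direction of the second one. *)
Lemma mean_Phiu_hu_cross i j k : i != j ->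
  \int[P]_w ((Phi i w * u k (U i w)) * (h (X j w) * u k (U j w))) = 0.
Proof.
move=> ij.
have mY : measurable_fun [set: T] (fun w => ((U i w, X i w), X j w)).
  by apply: measurable_fun_pair => //; exact: measurable_fun_pair.
pose Y : {mfun T >-> (T1 * T2 * T2)%type} := mfun_Sub (mem_set mY).
pose phi (z : T1 * ((T1 * T2) * T2)) :=
  ((F z.2.1 - b0 z.2.1.2) * u k z.2.1.1 * h z.2.2) * u k z.1.
transitivity (\int[P]_w (phi (U j w, Y w))).
  by apply: eq_Rintegral => w _; rewrite /phi /Phi /=; ring.
apply: (@indep_integral0 _ _ _ P _ _ _ _ S (U j) Y).
- by move=> A B mA mB; exact: indep_cross.
- have m21 : measurable_fun setT (fun z : T1 * ((T1 * T2) * T2) => z.2.1).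
    exact: (measurableT_comp measurable_fst measurable_snd).
  have m22 : measurable_fun setT (fun z : T1 * ((T1 * T2) * T2) => z.2.2).
    exact: (measurableT_comp measurable_snd measurable_snd).
  have m211 : measurable_fun setT (fun z : T1 * ((T1 * T2) * T2) => z.2.1.1).
    exact: (measurableT_comp measurable_fst m21).
  have m212 : measurable_fun setT (fun z : T1 * ((T1 * T2) * T2) => z.2.1.2).
    exact: (measurableT_comp measurable_snd m21).
  rewrite /phi; apply: measurable_funM; last first.
    exact: (measurableT_comp (mu k) measurable_fst).
  apply: measurable_funM; last exact: (measurableT_comp mh m22).
  apply: measurable_funM; last exact: (measurableT_comp (mu k) m211).
  apply: measurable_funB; first exact: (measurableT_comp mF m21).
  exact: (measurableT_comp mb0 m212).
- have := sq_integrableM (Phiu_sq_integrable i k) (hu_sq_integrable j k).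
  by under eq_fun do rewrite mulrA.
- by move=> y; rewrite /phi /=; exact: integral0Z.
Qed.

End Perturbation.

Variable a : R.
Hypothesis a_neq0 : a != 0.

(** The k-th coordinate of the estimator with baseline b. *)
Definition estimator (b : T2 -> R) k w : R :=
  a * \sum_i (F (U i w, X i w) - b (X i w)) * u k (U i w).

Let estimatorB (b : T2 -> R) k w : estimator b0 k w - estimator b k w =
  a * \sum_i (b (X i w) - b0 (X i w)) * u k (U i w).
Proof.
rewrite /estimator -mulrBr -sumrB; congr (_ * _); apply: eq_bigr => i _; ring.
Qed.

Let estimator_b0_sq k : sq_integrable P (estimator b0 k).
Proof.
apply: sq_integrableZ; apply: sq_integrable_sum => i.
exact: Phiu_sq_integrable.
Qed.

Let measurable_estimator (b : T2 -> R) k : measurable_fun [set: T2] b ->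
  measurable_fun [set: T] (estimator b k).
Proof.
move=> mb; apply: measurable_funM => //; apply: measurable_sum => i.
apply: measurable_funM; last exact: measurableT_comp.
apply: measurable_funB; last exact: measurableT_comp.
by apply: (measurableT_comp mF); exact: measurable_fun_pair.
Qed.

(** With square integrable weights, the difference of two estimators has mean
    zero and is orthogonal to the estimator with the mean baseline. *)
Let mean_estimatorB (b : T2 -> R) k : measurable_fun [set: T2] b ->
  (forall i, sq_integrable P (fun w => b (X i w) - b0 (X i w))) ->
  \int[P]_w (estimator b0 k w - estimator b k w) = 0.
Proof.
move=> mb h2; pose h y := b y - b0 y.
have mh : measurable_fun [set: T2] h by exact: measurable_funB.
have ih i := sq_integrable_integrable (hu_sq_integrable (h := h) h2 i k).
under eq_Rintegral do rewrite estimatorB.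
rewrite RintegralZl//; last exact: integrable_sum_fun.
rewrite Rintegral_sum// big1 ?mulr0// => i _.
exact: (mean_hu mh h2).
Qed.

Let orthogonal_estimatorB (b : T2 -> R) : measurable_fun [set: T2] b ->
  (forall i, sq_integrable P (fun w => b (X i w) - b0 (X i w))) ->
  \int[P]_w
    (\sum_k estimator b0 k w * (estimator b0 k w - estimator b k w)) = 0.
Proof.
move=> mb h2; pose h y := b y - b0 y.
have mh : measurable_fun [set: T2] h by exact: measurable_funB.
have Ph i j k := sq_integrableM (Phiu_sq_integrable i k)
  (hu_sq_integrable (h := h) h2 j k).
transitivity (\int[P]_w (a ^+ 2 * \sum_i \sum_j \sum_k
    (Phi i w * u k (U i w)) * (h (X j w) * u k (U j w)))).
  apply: eq_Rintegral => w _; under eq_bigr do rewrite estimatorB.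
  rewrite mulr_sumr; under [RHS]eq_bigr do rewrite exchange_big /=.
  under [RHS]eq_bigr do rewrite mulr_sumr.
  rewrite exchange_big; apply: eq_bigr => k _.
  rewrite /estimator mulrACA -expr2 -mulr_sumr; congr (_ * _).
  rewrite mulr_suml; apply: eq_bigr => i _.
  by rewrite mulr_sumr.
have iPh i j : P.-integrable [set: T] (EFin \o (fun w => \sum_k
    (Phi i w * u k (U i w)) * (h (X j w) * u k (U j w)))).
  by apply: integrable_sum_fun => // k; exact: Ph.
rewrite RintegralZl//; last first.
  by apply: integrable_sum_fun => // i; exact: integrable_sum_fun.
rewrite Rintegral_sum// => [|i]; last exact: integrable_sum_fun.
rewrite big1 ?mulr0// => i _; rewrite Rintegral_sum// big1// => j _.
have [->|ij] := eqVneq i j; first exact: (mean_Phiu_hu_diag mh h2).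
by rewrite Rintegral_sum// big1// => k _; exact: (mean_Phiu_hu_cross mh h2).
Qed.

(** Among all measurable baselines, the mean b0 of F over the directions
    minimizes the total variance.  If estimator b k is not integrable, its
    integral below is a conventional real number; the right-hand side is then
    infinite. *)
Lemma estimator_variance_min (b : T2 -> R) (mb : measurable_fun [set: T2] b) :
  (\int[P]_w (\sum_k (estimator b0 k w -
      \int[P]_w' (estimator b0 k w')) ^+ 2)%:E <=
   \int[P]_w (\sum_k (estimator b k w -
      \int[P]_w' (estimator b k w')) ^+ 2)%:E)%E.
Proof.
set m0 := fun k => \int[P]_w' (estimator b0 k w').
set m := fun k => \int[P]_w' (estimator b k w').
rewrite -/(m0 _) -/(m _).
have mZ k : measurable_fun [set: T] (fun w => (estimator b k w - m k) ^+ 2).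
  apply: measurable_funX; apply: measurable_funB => //.
  exact: measurable_estimator.
have [->|] :=
  eqVneq (\int[P]_w (\sum_k (estimator b k w - m k) ^+ 2)%:E)%E +oo%E.
  exact: leey.
rewrite -ltey => fin.
have Zb2 k : sq_integrable P (estimator b k).
  have : sq_integrable P (fun w => estimator b k w - m k).
    split; first by apply: measurable_funB => //; exact: measurable_estimator.
    apply/integrableP; split; first exact/measurable_EFinP.
    apply: le_lt_trans fin; apply: ge0_le_integral => //.
    - by apply/measurable_EFinP; exact: measurableT_comp.
    - by apply/measurable_EFinP; exact: measurable_sum.
    move=> w _; rewrite gee0_abs ?lee_fin ?sqr_ge0// (bigD1 k)//= lerDl.
    by rewrite sumr_ge0// => j _; rewrite sqr_ge0.
  move=> /sq_integrableD /(_ (sq_integrable_cst P (m k))).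
  by under eq_fun do rewrite subrK.
have W2 k : sq_integrable P (fun w => estimator b0 k w - estimator b k w).
  exact: sq_integrableB.
have h2 i : sq_integrable P (fun w => b (X i w) - b0 (X i w)).
  apply: (weight_sq_integrable (h := fun y => b y - b0 y)).
    exact: measurable_funB.
  move=> k; have := sq_integrableZ a^-1 (W2 k).
  by under eq_fun do rewrite estimatorB mulKf//.
(* All baselines with finite variance give the same mean. *)
have mm k : m k = m0 k.
  apply/esym/subr0_eq; rewrite /m /m0 -RintegralB//.
  - exact: mean_estimatorB.
  - exact: sq_integrable_integrable.
  - exact: sq_integrable_integrable.
have iW k := sq_integrable_integrable (W2 k).
have i0 : P.-integrable [set: T]
    (EFin \o (fun w => \sum_k (estimator b0 k w - m0 k) ^+ 2)).
  apply: integrable_sum_fun => // k.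
  by have [] := sq_integrableB (estimator_b0_sq k) (sq_integrable_cst P (m0 k)).
have i1 : P.-integrable [set: T]
    (EFin \o (fun w => \sum_k (estimator b k w - m k) ^+ 2)).
  apply: integrable_sum_fun => // k.
  by have [] := sq_integrableB (Zb2 k) (sq_integrable_cst P (m k)).
have i2 : P.-integrable [set: T] (EFin \o (fun w => \sum_k
    (estimator b0 k w - m0 k) * (estimator b0 k w - estimator b k w))).
  apply: integrable_sum_fun => // k; apply: sq_integrableM => //.
  exact: sq_integrableB (estimator_b0_sq k) (sq_integrable_cst P (m0 k)).
have ort : \int[P]_w (\sum_k
    (estimator b0 k w - m0 k) * (estimator b0 k w - estimator b k w)) = 0.
  have iZW k := sq_integrableM (estimator_b0_sq k) (W2 k).
  have imW k : P.-integrable [set: T] (EFin \o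
      (fun w => m0 k * (estimator b0 k w - estimator b k w))).
    exact: integrableZ_fun.
  under eq_Rintegral do under eq_bigr do rewrite mulrBl.
  under eq_Rintegral do rewrite sumrB.
  rewrite RintegralB//; [|exact: integrable_sum_fun|exact: integrable_sum_fun].
  rewrite orthogonal_estimatorB// sub0r Rintegral_sum// big1 ?oppr0// => k _.
  by rewrite RintegralZl// mean_estimatorB// mulr0.
have fine_le : \int[P]_w (\sum_k (estimator b0 k w - m0 k) ^+ 2) <=
    \int[P]_w (\sum_k (estimator b k w - m k) ^+ 2).
  pose g w := \sum_k (estimator b0 k w - m0 k) ^+ 2 - 2 * \sum_k
    (estimator b0 k w - m0 k) * (estimator b0 k w - estimator b k w).
  have <- : \int[P]_w g w = \int[P]_w (\sum_k (estimator b0 k w - m0 k) ^+ 2).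
    rewrite /g RintegralB//; last exact: integrableZ_fun.
    by rewrite RintegralZl// ort mulr0 subr0.
  apply: le_Rintegral => //.
    rewrite (_ : EFin \o _ = ((EFin \o (fun w => (\sum_k (estimator b0 k w -
      m0 k) ^+ 2)%R)) \- (EFin \o (fun w => (2 * \sum_k (estimator b0 k w -
      m0 k) * (estimator b0 k w - estimator b k w))%R)))%E).
      by apply: integrableB => //; exact: integrableZ_fun.
    by apply/funext => w /=; rewrite EFinB.
  (* Coordinatewise, (x - w) ^ 2 >= x ^ 2 - 2 x w. *)
  move=> w _; rewrite /g mulr_sumr -sumrB; apply: ler_sum => k _; rewrite mm.
  by have := sqr_ge0 (estimator b0 k w - estimator b k w); nra.
rewrite -(fineK (integrable_fin_num measurableT i0)).
by rewrite -[leRHS](fineK (integrable_fin_num measurableT i1)) lee_fin.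
Qed.

End Baseline.
End Samples.

(** * The uniform distribution on the sphere *)

Section Borel.
Variable R : realType.

Lemma continuous_borel_measurable m n (f : 'M[R]_(m, n) -> R) : continuous f ->
  measurable_fun [set: borel_mx R m n] (f : borel_mx R m n -> R).
Proof.
move=> cf; apply: (measurability _ (RGenOInfty.measurableE R)).
move=> _ [_ [a ->] <-]; rewrite setTI; apply: sub_sigma_algebra.
by move/continuousP : cf; apply; exact: interval_open.
Qed.

Lemma measurable_coord m n i j : measurable_fun [set: borel_mx R m n]
  (fun M : borel_mx R m n => (M : 'M[R]_(m, n)) i j : R).
Proof. by apply: continuous_borel_measurable; exact: coord_continuous. Qed.

Lemma frob_sqr m n (M : 'M[R]_(m, n)) :
  frob M ^+ 2 = \sum_k M k.1 k.2 ^+ 2.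
Proof.
rewrite /frob sqr_sqrtr; last first.
  by apply: sumr_ge0 => i _; apply: sumr_ge0 => j _; exact: sqr_ge0.
by rewrite (pair_bigA _ (fun i j => M i j ^+ 2)).
Qed.

Lemma mx_norm_le_frob m n (M : 'M[R]_(m, n)) : `|M| <= frob M.
Proof.
apply: mx_norm_le => [|i j]; first exact: sqrtr_ge0.
rewrite -sqrtr_sqr; apply: ler_wsqrtr.
rewrite (bigD1 i)//= (bigD1 j)//= -addrA lerDl addr_ge0//.
  by apply: sumr_ge0 => *; exact: sqr_ge0.
by apply: sumr_ge0 => *; apply: sumr_ge0 => *; exact: sqr_ge0.
Qed.

End Borel.

Section UniformSphere.
Variables (R : realType) (m p : nat) (S : probability (borel_mx R m p) R).
Hypothesis hS : uniform_sphere S.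

Lemma uniform_sphere_ae :
  {ae S, forall V : borel_mx R m p,
    frob (V : 'M[R]_(m, p)) = Num.sqrt (m * p)%:R}.
Proof.
have [S1 _] := hS.
pose q (V : 'M[R]_(m, p)) : R := \sum_k V k.1 k.2 ^+ 2.
have mE : measurable ([set V : 'M[R]_(m, p) | frob V = Num.sqrt (m * p)%:R]
    : set (borel_mx R m p)).
  have mq : measurable_fun [set: borel_mx R m p] (q : borel_mx R m p -> R).
    apply: measurable_sum => k; apply: measurable_funX.
    exact: measurable_coord.
  rewrite (_ : [set _ | _] = setT `&` q @^-1` [set (m * p)%:R]).
    by apply: mq => //; exact: measurable_set1.
  apply/seteqP; split => V /=.
    by move=> fV; split=> //; rewrite /q -frob_sqr fV sqr_sqrtr.
  move=> [_]; rewrite /q -frob_sqr => <-.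
  by rewrite sqrtr_sqr ger0_norm// sqrtr_ge0.
exists (~` [set V : 'M[R]_(m, p) | frob V = Num.sqrt (m * p)%:R]); split.
- exact: measurableC.
- apply: etrans (probability_setC S mE) _.
  by rewrite S1 subee.
- by [].
Qed.

(** The measure is invariant under the orthogonal transformation V |-> - V. *)
Lemma uniform_sphere_mean i j :
  (\int[S]_V ((V : 'M[R]_(m, p)) i j)%:E = 0)%E.
Proof.
have [_ Sinv] := hS.
pose f (V : borel_mx R m p) : R := (V : 'M[R]_(m, p)) i j.
have mf : measurable_fun [set: borel_mx R m p] f by exact: measurable_coord.
have fi : S.-integrable setT (EFin \o f).
  apply: (@ae_bounded_integrable _ _ _ S _ (Num.sqrt (m * p)%:R)) => //.
  apply: filterS uniform_sphere_ae => V <-.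
  by rewrite (le_trans (coord_le_mx_norm _ _ _))// mx_norm_le_frob.
pose g (V : borel_mx R m p) : borel_mx R m p := - (V : 'M[R]_(m, p)).
have mg : measurable_fun [set: borel_mx R m p] g.
  apply: (@measurability _ _ _ _ setT g (@open 'M[R]_(m, p))) => //.
  move=> _ [W oW <-]; rewrite setTI; apply: sub_sigma_algebra.
  have /continuousP : continuous (@GRing.opp 'M[R]_(m, p)).
    exact: opp_continuous.
  by apply.
have inv (E : set (borel_mx R m p)) : measurable E -> S (g @^-1` E) = S E.
  move=> mE; rewrite -(Sinv (- 1%:M) _ E mE); last first.
    by rewrite linearN /= mulNmx mul1mx trmx1 opprK.
  congr (S _); apply/seteqP; split=> V; rewrite /g /=.
    by rewrite mulmxN mulmx1 linearN /= mxvecK.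
  by rewrite mulmxN mulmx1 linearN /= mxvecK.
pose Y : {mfun borel_mx R m p >-> borel_mx R m p} := mfun_Sub (mem_set mg).
have ifg : S.-integrable setT ((EFin \o f) \o Y).
  rewrite (_ : _ \o _ = EFin \o (fun V => - 1 * f V)).
    exact: integrableZ_fun.
  by apply/funext => V /=; rewrite /f /g mxE mulN1r.
have eqN : (\int[S]_V (f V)%:E = - \int[S]_V (f V)%:E)%E.
  rewrite [LHS](eq_measure_integral (distribution S Y)) => [|A mA _].
    rewrite (integral_distribution _ ifg); last exact/measurable_EFinP.
    rewrite -integralN/=; last exact: integrable_add_def.
    by apply: eq_integral => V _ /=; rewrite /f /g mxE EFinN.
  exact/esym/inv.
have := integrable_fin_num measurableT fi.
rewrite -/(f _); move: eqN; rewrite /comp; case: integral => // e [] /eqP.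
by rewrite -addr_eq0 -mulr2n mulrn_eq0 /= => /eqP ->.
Qed.

End UniformSphere.

(** * The optimal baseline *)

Section OptimalBaseline.
Variables (R : realType) (n m p : nat).
Variables (A : 'M[R]_n) (B : 'M[R]_(n, m)) (C : 'M[R]_(p, n)).
Variables (Q : 'M[R]_p) (Rw : 'M[R]_m).
Variables (S : probability (borel_mx R m p) R) (hS : uniform_sphere S).
Variables (tau : R) (tau_ge0 : 0 <= tau).
Implicit Types (K : 'M[R]_(m, p)) (x : 'cV[R]_n).

(* The radius of the sphere. *)
Let kappa : R := Num.sqrt (m * p)%:R.

Let kappa_ge0 : 0 <= kappa. Proof. exact: sqrtr_ge0. Qed.

Let smoothing_le K r (V : 'M[R]_(m, p)) : frob V = kappa ->
  `|K + r *: V| <= `|K| + `|r| * kappa.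
Proof.
move=> Vk; rewrite (le_trans (ler_normD _ _))// lerD2l normrZ ler_wpM2l//.
by rewrite -Vk mx_norm_le_frob.
Qed.

Lemma opt_baselineE r K x : opt_baseline A B C Q Rw S tau r K x =
  \int[S]_V (finite_cost A B C Q Rw tau (K + r *: (V : 'M[R]_(m, p))) x).
Proof. by rewrite /opt_baseline unlock. Qed.

Lemma lip_bounded_smoothing (V : normedModType R) (f : 'M[R]_(m, p) -> V) K r :
  lip_bounded f -> lip_bounded (fun W => f (K + r *: W)).
Proof.
move=> fL; apply: (lip_bounded_comp fL); apply: lip_boundedD.
  exact: lip_bounded_cst.
apply: lip_boundedZ; last exact: lip_bounded_id.
exact: lip_bounded_cst.
Qed.

Lemma lip_bounded_sphere_integrable (f : 'M[R]_(m, p) -> R) : lip_bounded f ->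
  S.-integrable [set: borel_mx R m p] (EFin \o (f : borel_mx R m p -> R)).
Proof.
move=> fL; have [M _ fM] := lip_bounded_bound fL kappa.
apply: (@ae_bounded_integrable _ _ _ S _ M).
  by apply: continuous_borel_measurable; exact: lip_bounded_continuous.
apply: filterS (uniform_sphere_ae hS) => V Vk.
by apply: fM; rewrite (le_trans (mx_norm_le_frob _))// Vk.
Qed.

(** The optimal baseline is a quadratic form in the initial state. *)
Lemma measurable_opt_baseline r K : measurable_fun [set: borel_cV R n]
  (opt_baseline A B C Q Rw S tau r K : borel_cV R n -> R).
Proof.
have iG kl : S.-integrable setT (EFin \o (fun V : borel_mx R m p =>
    int_cost_mx A B C Q Rw tau (K + r *: (V : 'M[R]_(m, p))) kl.1 kl.2)).
  apply: (@lip_bounded_sphere_integrable (fun V =>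
    int_cost_mx A B C Q Rw tau (K + r *: V) kl.1 kl.2)).
  apply: (lip_bounded_smoothing (V := R)
    (f := fun W => int_cost_mx A B C Q Rw tau W kl.1 kl.2)).
  exact: lip_bounded_int_cost_mx.
rewrite (_ : opt_baseline A B C Q Rw S tau r K = fun x =>
  \sum_kl (x kl.1 ord0 * x kl.2 ord0) * \int[S]_V
    int_cost_mx A B C Q Rw tau (K + r *: (V : 'M[R]_(m, p))) kl.1 kl.2).
  apply: measurable_sum => kl; apply: measurable_funM => //.
  by apply: measurable_funM; exact: measurable_coord.
apply/funext => x; rewrite opt_baselineE.
under eq_Rintegral do rewrite finite_costE.
rewrite Rintegral_sum//; last by move=> kl; exact: integrableZ_fun.
by apply: eq_bigr => kl _; rewrite RintegralZl.
Qed.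

(** The cost is a finite sum of products of a function of the gain and a
    function of the state, so it is measurable for the product of the Borel
    sigma-algebras. *)
Lemma measurable_smoothed_cost r K :
  measurable_fun [set: borel_mx R m p * borel_cV R n]
    (fun z => finite_cost A B C Q Rw tau (K + r *: (z.1 : 'M[R]_(m, p)))
      (z.2 : 'cV[R]_n)).
Proof.
under eq_fun do rewrite finite_costE.
apply: measurable_sum => kl; apply: measurable_funM.
  apply: measurable_funM.
    exact: (measurableT_comp (measurable_coord kl.1 ord0) measurable_snd).
  exact: (measurableT_comp (measurable_coord kl.2 ord0) measurable_snd).
have mG : measurable_fun [set: borel_mx R m p] (fun V : borel_mx R m p =>
    int_cost_mx A B C Q Rw tau (K + r *: (V : 'M[R]_(m, p))) kl.1 kl.2).
  apply: (@continuous_borel_measurable _ _ _ (fun V : 'M[R]_(m, p) =>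
    int_cost_mx A B C Q Rw tau (K + r *: V) kl.1 kl.2)).
  apply: lip_bounded_continuous; apply: (lip_bounded_smoothing (V := R)
    (f := fun W => int_cost_mx A B C Q Rw tau W kl.1 kl.2)).
  exact: lip_bounded_int_cost_mx.
exact: (measurableT_comp mG measurable_fst).
Qed.

Lemma smoothed_cost_integrable r K x : S.-integrable [set: borel_mx R m p]
  (EFin \o (fun V : borel_mx R m p =>
    finite_cost A B C Q Rw tau (K + r *: (V : 'M[R]_(m, p))) x)).
Proof.
apply: (@lip_bounded_sphere_integrable (fun V =>
  finite_cost A B C Q Rw tau (K + r *: V) x)).
apply: (lip_bounded_smoothing (V := R)
  (f := fun W => finite_cost A B C Q Rw tau W x)).
exact: lip_bounded_finite_cost.
Qed.

Lemma smoothed_cost_bounded r K sigma : exists M, forall (V : 'M[R]_(m, p)) x,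
  frob V = kappa -> frob x <= sigma ->
  `|finite_cost A B C Q Rw tau (K + r *: V) x| <= M.
Proof.
have [M Mb] :=
  finite_cost_bounded A B C Q Rw (`|K| + `|r| * kappa) sigma tau_ge0.
exists M => V x Vk xs; apply: Mb; first exact: smoothing_le.
by rewrite (le_trans (mx_norm_le_frob _)).
Qed.

Lemma opt_baseline_bounded r K sigma M :
  (forall (V : 'M[R]_(m, p)) x, frob V = kappa -> frob x <= sigma ->
    `|finite_cost A B C Q Rw tau (K + r *: V) x| <= M) ->
  forall x, frob x <= sigma -> `|opt_baseline A B C Q Rw S tau r K x| <= M.
Proof.
move=> Mb x xs; rewrite opt_baselineE.
apply: (@ae_bounded_Rintegral _ _ _ S).
  by have /integrableP[/measurable_EFinP] := smoothed_cost_integrable r K x.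
by apply: filterS (uniform_sphere_ae hS) => V Vk; exact: Mb.
Qed.

(** The cost is Lipschitz near K, so averaging it over a sphere of radius
    r * kappa around K moves it by O(r). *)
Lemma opt_baseline_cvg K x :
  opt_baseline A B C Q Rw S tau r K x @[r --> 0^'+] -->
  finite_cost A B C Q Rw tau K x.
Proof.
have [L L0 fL] := lip_bounded_finite_cost A B C Q Rw x tau_ge0 (`|K| + kappa).
have near0 r : 0 < r -> r <= 1 ->
  `|finite_cost A B C Q Rw tau K x - opt_baseline A B C Q Rw S tau r K x| <=
    L * kappa * r.
  move=> r0 r1; have ic := smoothed_cost_integrable r K x.
  have icst := @integrable_cst_fun _ _ _ S (finite_cost A B C Q Rw tau K x).
  rewrite (_ : _ - _ = \int[S]_V (finite_cost A B C Q Rw tau K x -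
      finite_cost A B C Q Rw tau (K + r *: (V : 'M[R]_(m, p))) x)); last first.
    rewrite (RintegralB measurableT icst ic) opt_baselineE; congr (_ - _).
    rewrite Rintegral_cst//; apply/esym.
    apply: (etrans (congr1 (fun e => _ * fine e) (probability_setT S))).
    exact: mulr1.
  apply: (@ae_bounded_Rintegral _ _ _ S).
    apply: measurable_funB => //.
    by have /integrableP[/measurable_EFinP] := ic.
  apply: filterS (uniform_sphere_ae hS) => V Vk.
  rewrite (le_trans (fL _ _ _ _))//; first by rewrite lerDl.
    rewrite (le_trans (smoothing_le _ _ Vk))// lerD2l ger0_norm ?(ltW r0)//.
    by rewrite ler_piMl.
  rewrite opprD addNKr normrN normrZ gtr0_norm// -mulrA ler_wpM2l// mulrC.
  by rewrite ler_wpM2r ?(ltW r0)// (le_trans (mx_norm_le_frob _))// Vk.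
have Lk : 0 < L * kappa + 1 by rewrite ltr_wpDl// mulr_ge0.
apply/cvgrPdist_le => /= e e0; near=> r.
have r0 : 0 < r by [].
rewrite (le_trans (near0 _ r0 _))//.
  by near: r; apply: nbhs_right_le.
rewrite (@le_trans _ _ ((L * kappa + 1) * r))//.
  by rewrite ler_wpM2r ?(ltW r0)// lerDl.
rewrite mulrC -ler_pdivlMr//; near: r; apply: nbhs_right_le.
by rewrite divr_gt0.
Unshelve. all: by end_near. Qed.

End OptimalBaseline.

(** * The theorem *)

Lemma mxvarE d (T : measurableType d) (R : realType) (P : probability T R)
    m n (Z : T -> 'M[R]_(m, n)) :
  mxvar P Z = (\int[P]_w (\sum_k (Z w k.1 k.2 -
    \int[P]_w' (Z w' k.1 k.2)) ^+ 2)%:E)%E.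
Proof.
rewrite /mxvar unlock; apply: eq_integral => w _; congr EFin.
by rewrite frob_sqr; apply: eq_bigr => k _; rewrite !mxE unlock.
Qed.

Theorem theorem4 (R : realType) (n m p : nat)
  (A : 'M[R]_n) (B : 'M[R]_(n, m)) (C : 'M[R]_(p, n))
  (Q : 'M[R]_p) (Rw : 'M[R]_m)
  (hB : B != 0) (hC : C != 0) (hQ : posdef Q) (hRw : posdef Rw)
  (hobs : observable A C)
  (* the distribution of the initial state *)
  (D : probability (borel_cV R n) R)
  (hSigma : posdef (mxmean D (fun x : 'cV[R]_n => x *m x^T)))
  (bound : R) (hbound : 0 < bound)
  (hD : {ae D, forall x : borel_cV R n, frob (x : 'cV[R]_n) <= bound})
  (* the feasible set *)
  (Omega : set 'M[R]_(m, p)) (hOclosed : closed Omega)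
  (hOconvex : convex_set (Omega : set (convex_lmodType 'M[R]_(m, p))))
  (hO : exists K0, Omega K0 /\ stabilizing A B C K0)
  (* the smoothing distribution *)
  (S : probability (borel_mx R m p) R) (hS : uniform_sphere S)
  (* the samples *)
  (d : measure_display) (T : measurableType d) (P : probability T R)
  (N : nat) (hN : (0 < N)%N)
  (U : 'I_N -> {RV P >-> borel_mx R m p})
  (X : 'I_N -> {RV P >-> borel_cV R n})
  (hU : forall i (E : set (borel_mx R m p)), measurable E ->
     distribution P (U i) E = S E)
  (hX : forall i (E : set (borel_cV R n)), measurable E ->
     distribution P (X i) E = D E)
  (hindep : mutually_independent P
     (fun k : 'I_N + 'I_N =>
        match k with inl i => sigma_of (U i) | inr i => sigma_of (X i) end))
  (a : R) (ha : 0 < a) (r0 : R) (hr0 : 0 < r0)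
  (hr0S : forall (r : R) (K V : 'M[R]_(m, p)), 0 < r -> r <= r0 ->
     sublevel A B C Q Rw D a K -> frob V = Num.sqrt (m * p)%:R ->
     sublevel A B C Q Rw D (2 * a) (K + r *: V))
  (tau : R) (htau : 0 < tau)
  (K : 'M[R]_(m, p)) (hK : sublevel A B C Q Rw D a K) :
  let ft := finite_cost A B C Q Rw tau in
  let bstar := opt_baseline A B C Q Rw S tau in
  let grad (r : R) (b : 'cV[R]_n -> R) (w : T) :=
    grad_estimate A B C Q Rw tau r K b
      (fun i => U i w) (fun i => X i w) in
  (forall r : R, 0 < r -> r <= r0 ->
     measurable_fun [set: borel_cV R n] (bstar r K : borel_cV R n -> R) /\
     forall b : borel_cV R n -> R, measurable_fun [set: borel_cV R n] b ->
       (mxvar P (grad r (bstar r K)) <= mxvar P (grad r b))%E) /\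
  (forall x : 'cV[R]_n, bstar r K x @[r --> 0^'+] --> ft K x).
Proof.
move=> ft bstar grad; split; last first.
  by move=> x; exact: (opt_baseline_cvg hS (ltW htau) (x := x)).
move=> r r_gt0 _; have tau0 := ltW htau; split.
  exact: (measurable_opt_baseline A B C Q Rw hS tau0).
move=> b mb.
(* The matrices B and C are nonzero, so m and p are positive. *)
have mp_gt0 : (0 : R) < (m * p)%:R.
  rewrite ltr0n muln_gt0; apply/andP; split.
    rewrite lt0n; apply: contraNneq hB => m0.
    by apply/eqP/matrixP => i j; case: j => j jm; exfalso; rewrite m0 in jm.
  rewrite lt0n; apply: contraNneq hC => p0.
  by apply/eqP/matrixP => i; case: i => i ip; exfalso; rewrite p0 in ip.
have [M Mb] := smoothed_cost_bounded A B C Q Rw tau0 r K bound.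
pose u (k : 'I_m * 'I_p) (V : borel_mx R m p) : R := (V : 'M[R]_(m, p)) k.1 k.2.
pose F (z : borel_mx R m p * borel_cV R n) : R :=
  finite_cost A B C Q Rw tau (K + r *: (z.1 : 'M[R]_(m, p))) (z.2 : 'cV[R]_n).
have a_neq0 : (r * N%:R)^-1 != 0.
  by rewrite invr_neq0// mulf_neq0 ?gt_eqF// ltr0n.
have u_sphere :
    {ae S, forall V : borel_mx R m p, \sum_k u k V ^+ 2 = (m * p)%:R}.
  apply: filterS (uniform_sphere_ae hS) => V Vk.
  by rewrite -[RHS]sqr_sqrtr ?ler0n// -Vk frob_sqr.
have F_bounded i : {ae P, forall w, `|F (U i w, X i w)| <= M}.
  apply: filterS2 (ae_sample1 hU i (uniform_sphere_ae hS)) (ae_sample2 hX i hD).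
  by move=> w; exact: Mb.
have F_mean y : (\int[S]_V (F (V, y))%:E = (bstar r K y)%:E)%E.
  rewrite /bstar opt_baselineE fineK//.
  exact: (integrable_fin_num measurableT
    (smoothed_cost_integrable A B C Q Rw hS tau0 r K y)).
have gradE b' k w : grad r b' w k.1 k.2 =
    estimator U X u F (r * N%:R)^-1 b' k w.
  rewrite /grad /grad_estimate mxE summxE; congr (_ * _).
  by apply: eq_bigr => i _; rewrite mxE.
have varE b' : (\int[P]_w (\sum_k (grad r b' w k.1 k.2 -
      \int[P]_w' (grad r b' w' k.1 k.2)) ^+ 2)%:E =
    \int[P]_w (\sum_k (estimator U X u F (r * N%:R)^-1 b' k w -
      \int[P]_w' (estimator U X u F (r * N%:R)^-1 b' k w')) ^+ 2)%:E)%E.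
  apply: eq_integral => w _; congr EFin; apply: eq_bigr => k _.
  rewrite gradE; congr ((_ - _) ^+ 2).
  by apply: eq_Rintegral => w' _; exact: gradE.
have := @estimator_variance_min _ _ _ P _ _ _ _ S D N U X hU hX hindep _ u
  (m * p)%:R (fun k => measurable_coord k.1 k.2) mp_gt0 u_sphere
  (fun k => uniform_sphere_mean hS k.1 k.2) F (bstar r K) M
  (measurable_smoothed_cost A B C Q Rw tau0 r K)
  (smoothed_cost_integrable A B C Q Rw hS tau0 r K) F_mean
  (measurable_opt_baseline A B C Q Rw hS tau0 r K) F_bounded.
have b_bounded : {ae D, forall y : borel_cV R n, `|bstar r K y| <= M}.
  apply: filterS hD => y yb.
  exact: (opt_baseline_bounded hS tau0 Mb).
move=> /(_ b_bounded _ a_neq0 b mb) vmin.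
by rewrite !mxvarE !varE.
Qed.
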